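(* Consider a multiclass queueing network under a preemptive-resume static-buffer-priority discipline as described in the context, whose Markov process has a stationary distribution, and let $X=(Z,R_e,R_s)$ be a random vector with that distribution. Then for every integer $n\ge0$ and every $c\in\mathbb R_+$ (as identities in $[0,\infty]$), $$\mathbb E\big[R_{e,k}^n1(R_{e,k}\ge c)\big]=\frac1{n+1}a_k^n\,\mathbb E\Big[\Big(T_{e,k}^{n+1}-\frac{c^{n+1}}{a_k^{n+1}}\Big)1(a_kT_{e,k}\ge c)\Big],\qquad k\in\mathcal E,$$ $$\mathbb E\big[R_{s,k}^n1(R_{s,k}\ge c,\,Z_k>0,\,Z_{H_+(k)}=0)\big]=\frac1{n+1}\gamma_km_k^n\,\mathbb E\Big[\Big(T_{s,k}^{n+1}-\frac{c^{n+1}}{m_k^{n+1}}\Big)1(m_kT_{s,k}\ge c)\Big],\qquad k\in\mathcal K.$$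
   Context: **Network.** There are $J$ single-server stations with unlimited waiting space and $K>J$ job classes $\mathcal K=\{1,\dots,K\}$; class $k$ is served at station $s(k)$. $\mathcal E\subset\mathcal K$ is the set of classes with external arrivals. External inter-arrival times to class $k\in\mathcal E$ are $a_kT_{e,k}(i)$, $i\ge1$, with $a_k=1/\lambda_k$, $\lambda_k>0$ ($\lambda_k=0$ for $k\notin\mathcal E$); the $i$th class $k$ service time is $m_kT_{s,k}(i)$, $m_k>0$; the job completing the $i$th class $k$ service becomes a class $\ell$ job if $\Phi^{(k)}(i)=e^{(\ell)}$ (the $\ell$th unit vector of $\mathbb R^K$) and leaves if $\Phi^{(k)}(i)=e^{(0)}=0$. All sequences are i.i.d. and mutually independent with generic elements $T_{e,k},T_{s,k}\ge0$ of mean one and with finite $(2+\delta_0)$-th moments for some $\delta_0>0$, and $\Phi^{(k)}$. $P_{k\ell}=\mathbb P\{\Phi^{(k)}=e^{(\ell)}\}$, and $I-P$ is invertible. $\alpha=(I-P^T)^{-1}\lambda$, $\gamma_k=\alpha_km_k$. **Discipline.** Classes at each station are strictly ranked; the server always works on the longest-waiting job of the highest-ranking non-empty class at its station, preemptive-resume. $H_+(k)$ is the set of classes at station $s(k)$ with priority strictly higher than $k$, and $Z_{H_+(k)}=(Z_\ell)_{\ell\in H_+(k)}$. **Markov process.** $X(t)=(Z(t),R_e(t),R_s(t))\in\mathbb Z_+^K\times\mathbb R_+^{\mathcal E}\times\mathbb R_+^K$ (right continuous): $Z_k(t)$ is the number of class $k$ jobs including one in service, $R_{e,k}(t)$ the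 remaining time until the next external arrival to class $k$, $R_{s,k}(t)$ the remaining service time of the class $k$ job in service (or the service time of the next class $k$ job if $Z_k(t)=0$). *)

(* Defs.v *)
From HB Require Import structures.
From mathcomp Require Export all_boot all_order all_algebra.
From mathcomp Require Export all_classical all_reals all_analysis.

Set Implicit Arguments.
Unset Strict Implicit.
Unset Printing Implicit Defensive.

Import Order.TTheory GRing.Theory Num.Theory.

Local Open Scope classical_set_scope.
Local Open Scope ring_scope.

Definition mutually_independent (d : measure_display) (Omega : measurableType d)
    (R : realType) (P : probability Omega R) (I : eqType) (D : set I)
    (G : I -> set_system Omega) : Prop :=
  forall (s : seq I) (A : I -> set Omega), uniq s ->
    (forall i, i \in s -> D i /\ G i (A i)) ->
    P (\bigcap_(i in [set` s]) A i) = \big[*%E/1%E]_(i <- s) P (A i).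

(* The parameters of a multiclass network: J stations, K classes, [external]
   the set of classes with external arrivals.  [rank] orders the classes sharing
   a station, a smaller rank being a higher priority. *)
Record network (R : realType) (J K : nat) := Network {
  station : 'I_K -> 'I_J ;
  external : {set 'I_K} ;
  arrival_rate : 'I_K -> R ;
  mean_service : 'I_K -> R ;
  rank : 'I_K -> nat ;
  more_classes : (J < K)%N ;
  arrival_rate_gt0 : forall k, k \in external -> 0 < arrival_rate k ;
  arrival_rate_eq0 : forall k, k \notin external -> arrival_rate k = 0 ;
  mean_service_gt0 : forall k, 0 < mean_service k ;
  rank_strict : forall k l, station k = station l -> rank k = rank l -> k = l }.

(* [unit_vec (Some l)] is e^(l) and [unit_vec None] is e^(0) = 0. *)
Definition unit_vec (K : nat) (o : option 'I_K) : K.-tuple nat :=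
  [tuple (o == Some l : nat) | l < K].

(* The i.i.d. sequences driving the network.  Sequences are indexed from 0 and
   the element of index 0 also plays the role of the generic element.  The
   sequences [arr k] with k outside [external] are not part of the model: they
   are never used and nothing is assumed about them. *)
Record primitives (R : realType) (J K : nat) (N : network R J K)
    (d : measure_display) (Omega : measurableType d)
    (P : probability Omega R) := Primitives {
  arr : 'I_K -> nat -> {RV P >-> R} ;
  srv : 'I_K -> nat -> {RV P >-> R} ;
  rte : 'I_K -> nat -> {RV P >-> K.-tuple nat} }.

Section Model.
Context {R : realType} {J K : nat} (N : network R J K).

Definition mean_arrival (k : 'I_K) : R := (arrival_rate N k)^-1.

Definition Hplus (k : 'I_K) : {set 'I_K} :=
  [set l | (station N l == station N k) && (rank N l < rank N k)%N]%SET.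

(* Indices of the primitive random variables: interarrival times, service times
   and routing vectors. *)
Definition prim_index : Type := (('I_K + 'I_K + 'I_K) * nat)%type.

Definition prim_valid : set prim_index :=
  [set i | if i.1 is inl (inl k) then k \in external N else true].

Section Primitives.
Context {d : measure_display} {Omega : measurableType d}
  {P : probability Omega R} (W : primitives N P).

Definition prim_sigma (i : prim_index) : set_system Omega :=
  match i with
  | (inl (inl k), n) => preimage_set_system setT (arr W k n) measurable
  | (inl (inr k), n) => preimage_set_system setT (srv W k n) measurable
  | (inr k, n) => preimage_set_system setT (rte W k n) measurable
  end.

Definition routing : 'M[R]_K :=
  \matrix_(k, l) fine (P [set w | rte W k 0%N w = unit_vec (Some l)]).

Definition alpha : 'cV[R]_K :=
  invmx (1%:M - routing^T) *m \col_k arrival_rate N k.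

Definition gamma (k : 'I_K) : R := alpha k ord0 * mean_service N k.

Record primitives_ok : Prop := PrimitivesOk {
  arr_ge0 : forall k, k \in external N -> forall i w, 0 <= arr W k i w ;
  srv_ge0 : forall k i w, 0 <= srv W k i w ;
  rte_unit : forall k i w, exists o, rte W k i w = unit_vec o ;
  arr_id : forall k, k \in external N -> forall i A, measurable A ->
    distribution P (arr W k i) A = distribution P (arr W k 0%N) A ;
  srv_id : forall k i A, measurable A ->
    distribution P (srv W k i) A = distribution P (srv W k 0%N) A ;
  rte_id : forall k i A, measurable A ->
    distribution P (rte W k i) A = distribution P (rte W k 0%N) A ;
  prim_independent : mutually_independent P prim_valid prim_sigma ;
  arr_mean : forall k, k \in external N -> 'E_P[arr W k 0%N]%E = 1%E ;
  srv_mean : forall k, 'E_P[srv W k 0%N]%E = 1%E ;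
  prim_moment : exists2 delta0 : R, 0 < delta0 &
    (forall k, k \in external N ->
       'E_P[fun w => (arr W k 0%N w `^ (2 + delta0))%R] < +oo)%E /\
    (forall k, 'E_P[fun w => (srv W k 0%N w `^ (2 + delta0))%R] < +oo)%E ;
  routing_inv : 1%:M - routing \in unitmx }.

End Primitives.

(* A state is (Z, R_e, R_s).  R_+^E is encoded as the set of nonnegative K-tuples
   vanishing outside E (see [state_space]). *)
Definition state : Type := (K.-tuple nat * K.-tuple R * K.-tuple R)%type.

Definition Zc (x : state) (k : 'I_K) : nat := tnth x.1.1 k.
Definition Rarr (x : state) (k : 'I_K) : R := tnth x.1.2 k.
Definition Rsrv (x : state) (k : 'I_K) : R := tnth x.2 k.

Definition state_space : set state :=
  [set x | (forall k, 0 <= Rarr x k) /\ (forall k, 0 <= Rsrv x k) /\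
           (forall k, k \notin external N -> Rarr x k = 0)].

(* The server of station s(k) is working on class k. *)
Definition in_service (x : state) (k : 'I_K) : bool :=
  (0 < Zc x k)%N && [forall l in Hplus k, Zc x l == 0%N].

(* [inl k] is an external arrival to class k, [inr k] a class k service
   completion. *)
Definition event : Type := ('I_K + 'I_K)%type.

Definition enabled (x : state) (e : event) : bool :=
  match e with
  | inl k => k \in external N
  | inr k => in_service x k
  end.

Definition residual (x : state) (e : event) : R :=
  match e with inl k => Rarr x k | inr k => Rsrv x k end.

Definition time_to_next (x : state) : \bar R :=
  \big[Order.min/+oo%E]_(e : event | enabled x e) (residual x e)%:E.

Definition due (x : state) : {set event} :=
  [set e | enabled x e && ((residual x e)%:E == time_to_next x)]%SET.

(* Evolution during r units of time without any event. *)
Definition elapse (r : R) (x : state) : state :=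
  (x.1.1,
   [tuple if k \in external N then Rarr x k - r else Rarr x k | k < K],
   [tuple if in_service x k then Rsrv x k - r else Rsrv x k | k < K]).

(* When several clocks expire together, the events are carried out one after the
   other (zero time apart); a tie rule selects the first of them. *)
Definition tie_rule : Type := K.-tuple nat -> {set event} -> event.

Definition tie_rule_ok (tie : tie_rule) : Prop :=
  forall z D, D != finset.set0 -> tie z D \in D.

Section Dynamics.
Context {d : measure_display} {Omega : measurableType d}
  {P : probability Omega R} (W : primitives N P) (tie : tie_rule).

(* A state together with the numbers of external arrivals and of service
   completions of each class so far: these tell which elements of the primitive
   sequences are used next. *)
Record config := Config {
  cstate : state ;
  narr : 'I_K -> nat ;
  nsrv : 'I_K -> nat }.

Definition fire (w : Omega) (e : event) (c : config) : config :=
  let x := cstate c in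
  match e with
  | inl k =>
      Config ([tuple (Zc x l + (l == k))%N | l < K],
              [tuple if l == k then mean_arrival k * arr W k (narr c k) w
                     else Rarr x l | l < K],
              x.2)
             (fun l => (narr c l + (l == k))%N) (nsrv c)
  | inr k =>
      Config ([tuple (Zc x l - (l == k) + tnth (rte W k (nsrv c k) w) l)%N
                 | l < K],
              x.1.2,
              [tuple if l == k then mean_service N k * srv W k (nsrv c k) w
                     else Rsrv x l | l < K])
             (narr c) (fun l => (nsrv c l + (l == k))%N)
  end.

Definition step (w : Omega) (c : config) : config :=
  let x := cstate c in
  if time_to_next x is r%:E then
    fire w (tie x.1.1 (due x)) (Config (elapse r x) (narr c) (nsrv c))
  else c.

Definition chain (w : Omega) (x : state) (n : nat) : config :=
  iter n (step w) (Config x (fun=> 0%N) (fun=> 0%N)).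

(* The time of the n-th event; it is +oo if fewer than n events ever occur. *)
Definition epoch (w : Omega) (x : state) (n : nat) : \bar R :=
  (\sum_(i < n) time_to_next (cstate (chain w x i)))%E.

(* [state_at w x t y] says that X(t) = y when X starts from x.  No such y
   exists if infinitely many events occur by time t (a null event). *)
Definition state_at (w : Omega) (x : state) (t : R) (y : state) : Prop :=
  exists n r, [/\ epoch w x n = r%:E, r <= t, (t%:E < epoch w x n.+1)%E &
    y = elapse (t - r) (cstate (chain w x n))].

Definition transition (t : R) (x : state) (A : set state) : \bar R :=
  P [set w | exists2 y, state_at w x t y & A y].

Definition stationary (pi : probability state R) : Prop :=
  pi state_space = 1%E /\
  forall t : R, 0 <= t -> forall A : set state, measurable A ->
    (\int[pi]_x transition t x A = pi A)%E.

End Dynamics.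
End Model.

Arguments state R K : clear implicits.
Arguments tie_rule K : clear implicits.

(* Main.v *)
From HB Require Import structures.
From mathcomp Require Import measurable_realfun ring lra.
Require Import Defs.

(* Run the network for one unit of time from its stationary law.  For an event e
   (an external arrival or a service completion) with clock R_e, and f with
   f(0) = 0, f(R_e) decreases by the integral of f'(R_e) over the time e is enabled
   and jumps from 0 to f(mean * T) when e happens.  The law of R_e at time 1 is its
   law at time 0, the expected time integral is E[f'(R_e); e enabled] by Fubini and
   stationarity, and the value T read at an event is independent of the past, so
       E[f'(R_e); e enabled] = rate(e) * E[f(mean * T)],
   where rate(e) is the expected number of events e.  The choice f(r) = r gives
   rate(arrival to k) = lambda_k and P(class k in service) = rate(e) * m_k; the same
   conservation argument for the number of class k jobs gives the traffic equations,
   so that rate(service completion of k) = alpha_k.  The choice f(r) = min(r, b) gives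
   P(R_e < b; e enabled) for every b, hence the law of R_e on {e enabled}: it has
   density rate(e) * P(mean * T > s), which has the moments claimed. *)

Set Implicit Arguments.
Unset Strict Implicit.
Unset Printing Implicit Defensive.

Import Order.TTheory GRing.Theory Num.Theory.
Import numFieldNormedType.Exports.

Local Open Scope classical_set_scope.
Local Open Scope ring_scope.

(** * Functions with values in a countable type *)

(** Neither the clocks nor the job counts are known to be integrable under the stationary law, so
    expectations of f(R_e) may not be subtracted; [balance] compares truncations instead. The value
    read at an event has a random index: the event is therefore split by that index, and the run is
    repeated with the value in question replaced by a default, which changes nothing until that
    value is read. Infinitely many events before time 1 would leave the final state undefined;
    stationarity applied to the whole space already gives such runs measure zero. Everything takes
    place on the product of the stationary law and [P], so that the initial state is independent of
    the primitives. Simultaneous events are carried out one by one, zero time apart; since f(0) = 0,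
    a clock waiting at 0 has no weight, and the path identity holds whatever the tie rule picks. *)

Section Discrete.
Context {d : measure_display} {T : measurableType d}.

(** Measurability for the full power set of [C], with no sigma-algebra structure put on [C]. Any
    function of a discrete function is again discrete, which is what an arbitrary tie rule
    requires. *)
Definition discrete_fun (C : Type) (h : T -> C) : Prop :=
  forall A : set C, measurable [set t | A (h t)].

Lemma discrete_funP (C : countType) (h : T -> C) :
  (forall c, measurable [set t | h t = c]) -> discrete_fun h.
Proof.
move=> mh A.
rewrite [X in measurable X](_ : _ =
  \bigcup_c ([set t | h t = c] `&` [set _ | A c])); last first.
  by apply/seteqP; split => [t At|t [c _ [/= -> //]]]; exists (h t).
apply: countable_bigcupT_measurable => [|c]; first exact: countableP.
have [Ac|nAc] := pselect (A c).
  by rewrite [X in _ `&` X](_ : _ = setT) ?setIT//; apply/seteqP; split.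
by rewrite [X in _ `&` X](_ : _ = set0) ?setI0//; apply/seteqP; split.
Qed.

Lemma discrete_fun_cst (C : Type) (c : C) : discrete_fun (fun=> c).
Proof.
move=> A; have [Ac|Ac] := pselect (A c).
  by rewrite [X in measurable X](_ : _ = setT)//; apply/seteqP; split.
by rewrite [X in measurable X](_ : _ = set0)//; apply/seteqP; split.
Qed.

Lemma discrete_fun_comp (C C' : Type) (g : C -> C') (h : T -> C) :
  discrete_fun h -> discrete_fun (fun t => g (h t)).
Proof. by move=> mh A; exact: (mh (fun c => A (g c))). Qed.

Lemma discrete_fun_pair (C C' : countType) (h : T -> C) (h' : T -> C') :
  discrete_fun h -> discrete_fun h' -> discrete_fun (fun t => (h t, h' t)).
Proof.
move=> mh mh'; apply: discrete_funP => -[c c'].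
rewrite [X in measurable X](_ : _ =
  [set t | h t = c] `&` [set t | h' t = c']); last first.
  by apply/seteqP; split => [t /= [<- <-]|t [/= -> ->]].
by apply: measurableI; [exact: (mh [set c])|exact: (mh' [set c'])].
Qed.

Lemma discrete_fun_comp2 (C C' : countType) (D : Type) (g : C -> C' -> D)
    (h : T -> C) (h' : T -> C') :
  discrete_fun h -> discrete_fun h' -> discrete_fun (fun t => g (h t) (h' t)).
Proof.
move=> mh mh'.
exact: (discrete_fun_comp (fun u => g u.1 u.2) (discrete_fun_pair mh mh')).
Qed.

Lemma discrete_fun_bool (b : T -> bool) : measurable_fun setT b -> discrete_fun b.
Proof.
move=> mb A; have := mb measurableT A.
by rewrite setTI; apply.
Qed.

Lemma discrete_fun_finset (I : finType) (b : I -> T -> bool) :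
  (forall i, discrete_fun (b i)) -> discrete_fun (fun t => [set i | b i t]%SET).
Proof.
move=> mb; apply: discrete_funP => D.
rewrite [X in measurable X](_ : _ =
  \bigcap_(i in [set: I]) [set t | b i t = (i \in D)]); last first.
  apply/seteqP; split => [t /= <- i _|t /= H]; first by rewrite inE.
  by apply/setP => i; rewrite inE; exact: H.
apply: fin_bigcap_measurable => [|i _]; first exact: finite_finset.
exact: (mb i [set (i \in D)]).
Qed.

(** A case distinction over countably many measurable pieces. It serves for the choice of the next
    event and for reading a sequence at a random index. *)
Lemma measurable_fun_glue (d' : measure_display) (U : measurableType d')
    (C : countType) (h : T -> C) (F : C -> T -> U) :
  discrete_fun h -> (forall c, measurable_fun setT (F c)) ->
  measurable_fun setT (fun t => F (h t) t).
Proof.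
move=> mh mF _ A mA; rewrite setTI.
rewrite [X in measurable X](_ : _ =
  \bigcup_(c in [set: C]) ([set t | h t = c] `&` (F c @^-1` A))); last first.
  by apply/seteqP; split => [t At|t [c _ [/= htc]]]; [exists (h t)|rewrite -htc].
apply: countable_bigcupT_measurable => [|c]; first exact: countableP.
apply: measurableI; first exact: (mh [set c]).
by rewrite -[X in measurable X]setTI; exact: mF.
Qed.

Lemma discrete_fun_glue (D : Type) (C : countType) (h : T -> C) (F : C -> T -> D) :
  discrete_fun h -> (forall c, discrete_fun (F c)) ->
  discrete_fun (fun t => F (h t) t).
Proof.
move=> mh mF A.
rewrite [X in measurable X](_ : _ =
  \bigcup_(c in [set: C]) ([set t | h t = c] `&` [set t | A (F c t)])); last first.
  by apply/seteqP; split => [t At|t [c _ [/= htc]]]; [exists (h t)|rewrite -htc].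
apply: countable_bigcupT_measurable => [|c]; first exact: countableP.
apply: measurableI; first exact: (mh [set c]).
exact: mF.
Qed.

Lemma discrete_fun_nat (h : T -> nat) : measurable_fun setT h -> discrete_fun h.
Proof.
by move=> mh A; rewrite -[X in measurable X]setTI; exact: mh.
Qed.

Lemma discrete_fun_tuple (n : nat) (h : T -> n.-tuple nat) :
  measurable_fun setT h -> discrete_fun h.
Proof.
move=> mh; apply: discrete_funP => c.
rewrite [X in measurable X](_ : _ =
  \bigcap_(i in [set: 'I_n]) [set t | tnth (h t) i = tnth c i]); last first.
  apply/seteqP; split => [t /= <- i _ //|t /= H].
  by apply: eq_from_tnth => i; exact: H.
apply: fin_bigcap_measurable => [|i _]; first exact: finite_finset.
have : measurable_fun setT (fun t => tnth (h t) i).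
  by move/measurable_fun_tnthP : mh; exact.
by move/discrete_fun_nat; exact: (fun H => H [set (tnth c i)]).
Qed.

Lemma measurable_fun_tuple (d' : measure_display) (U : measurableType d')
    (n : nat) (F : 'I_n -> T -> U) :
  (forall i, measurable_fun setT (F i)) ->
  measurable_fun setT (fun t => [tuple F i t | i < n]).
Proof.
move=> mF; apply/measurable_fun_tnthP => i.
by rewrite (_ : _ \o _ = F i)//; apply/funext => t /=; rewrite tnth_mktuple.
Qed.

Lemma discrete_fun_measurable_nat (h : T -> nat) :
  discrete_fun h -> measurable_fun setT h.
Proof. by move=> mh _ A _; rewrite setTI; exact: mh. Qed.

End Discrete.

(** * The embedded chain *)

Section Chain.
Context {R : realType} {J K : nat} (N : network R J K) (tie : tie_rule K).
Local Notation state := (state R K).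
Local Notation event := (@event K).
Local Notation config := (@Defs.config R K).

(* The values read along one run of the chain, detached from the probability
   space: the chain can then be run on modified values, and measured with respect
   to a smaller sigma-algebra. *)
Record draws := Draws {
  draw_arr : 'I_K -> nat -> R ;
  draw_srv : 'I_K -> nat -> R ;
  draw_rte : 'I_K -> nat -> K.-tuple nat }.

Definition next_event (x : state) : option event :=
  if time_to_next N x is _%:E then Some (tie x.1.1 (due N x)) else None.

Definition count (c : config) (e : event) : nat :=
  match e with inl k => narr c k | inr k => nsrv c k end.

Definition mean_clock (e : event) : R :=
  match e with inl k => mean_arrival N k | inr k => mean_service N k end.

Definition draw_clock (p : draws) (e : event) (i : nat) : R :=
  match e with inl k => draw_arr p k i | inr k => draw_srv p k i end.

Definition draw_jobs (p : draws) (e : event) (i : nat) (k : 'I_K) : nat :=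
  match e with inl l => (k == l) | inr l => tnth (draw_rte p l i) k end.

Definition dfire (p : draws) (e : event) (c : config) : config :=
  let x := cstate c in
  match e with
  | inl k =>
      Config ([tuple (Zc x l + (l == k))%N | l < K],
              [tuple if l == k then mean_arrival N k * draw_arr p k (narr c k)
                     else Rarr x l | l < K],
              x.2)
             (fun l => (narr c l + (l == k))%N) (nsrv c)
  | inr k =>
      Config ([tuple (Zc x l - (l == k) + tnth (draw_rte p k (nsrv c k)) l)%N
                 | l < K],
              x.1.2,
              [tuple if l == k then mean_service N k * draw_srv p k (nsrv c k)
                     else Rsrv x l | l < K])
             (narr c) (fun l => (nsrv c l + (l == k))%N)
  end.

Definition dstep (p : draws) (c : config) : config :=
  let x := cstate c in
  if time_to_next N x is r%:E then
    dfire p (tie x.1.1 (due N x)) (Config (elapse N r x) (narr c) (nsrv c))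
  else c.

Definition dchain (p : draws) (x : state) (n : nat) : config :=
  iter n (dstep p) (Config x (fun=> 0%N) (fun=> 0%N)).

Definition depoch (p : draws) (x : state) (n : nat) : \bar R :=
  (\sum_(i < n) time_to_next N (cstate (dchain p x i)))%E.

Lemma count_dfire p e c e' :
  count (dfire p e c) e' = (count c e' + (e' == e))%N.
Proof.
by case: e => k; case: e' => k' //=; rewrite addn0.
Qed.

Lemma residual_dfire p e c e' :
  residual (cstate (dfire p e c)) e' =
  if e' == e then mean_clock e * draw_clock p e (count c e)
  else residual (cstate c) e'.
Proof. by case: e => k; case: e' => k' //=; rewrite /Rarr /Rsrv ?tnth_mktuple. Qed.

Lemma Zc_dfire p e c k :
  Zc (cstate (dfire p e c)) k =
  (Zc (cstate c) k - (inr k == e) + draw_jobs p e (count c e) k)%N.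
Proof.
case: e => l //=; rewrite /Zc /= tnth_mktuple ?subn0//.
Qed.

Lemma enabled_elapse r x e : enabled N (elapse N r x) e = enabled N x e.
Proof. by case: e. Qed.

Lemma residual_elapse r x e :
  residual (elapse N r x) e = residual x e - (if enabled N x e then r else 0).
Proof.
by case: e => k /=; rewrite /Rarr /Rsrv /= tnth_mktuple; case: ifP => //; rewrite subr0.
Qed.

Lemma time_to_next_le x e :
  enabled N x e -> (time_to_next N x <= (residual x e)%:E)%E.
Proof. by move=> xe; rewrite /time_to_next (bigD1 e)//= ge_min lexx. Qed.

Lemma time_to_nextP x : (time_to_next N x = +oo)%E \/
  exists e, enabled N x e /\ time_to_next N x = (residual x e)%:E.
Proof.
rewrite /time_to_next.
apply: (@big_rec _ (fun u => (u = +oo)%E \/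
  exists e, enabled N x e /\ u = (residual x e)%:E)); first by left.
move=> e u xe [->|[e' [xe' ->]]].
  by right; exists e; split => //; apply/min_idPl; rewrite leey.
right; have [ee'|ee'] := leP (residual x e)%:E (residual x e')%:E.
  by exists e; split => //; exact/min_idPl.
by exists e'; split => //; apply/min_idPr; rewrite ltW.
Qed.

Hypothesis htie : tie_rule_ok tie.

Lemma next_eventP x r : time_to_next N x = r%:E ->
  exists e, [/\ next_event x = Some e, tie x.1.1 (due N x) = e,
                enabled N x e & residual x e = r].
Proof.
move=> xr; rewrite /next_event xr; exists (tie x.1.1 (due N x)).
suff /(htie x.1.1) : due N x != finset.set0.
  by rewrite inE xr => /andP[xe /eqP[xre]].
case: (time_to_nextP x) => [|[e [xe xre]]]; first by rewrite xr.
by apply/set0Pn; exists e; rewrite inE xe xre eqxx.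
Qed.

Lemma dstepE p c r e : time_to_next N (cstate c) = r%:E ->
  next_event (cstate c) = Some e ->
  dstep p c = dfire p e (Config (elapse N r (cstate c)) (narr c) (nsrv c)).
Proof. by rewrite /dstep /next_event => -> [<-]. Qed.

Lemma next_event_enabled x e : next_event x = Some e ->
  enabled N x e.
Proof.
move=> xe; case: (time_to_nextP x) => [xoo|[e' [_ /next_eventP]]].
  by move: xe; rewrite /next_event xoo.
by case=> e2 [+ _ ? _]; rewrite xe => -[->].
Qed.

Lemma next_event_fin x e : next_event x = Some e ->
  time_to_next N x = (residual x e)%:E.
Proof.
move=> xe; case: (time_to_nextP x) => [xoo|[e' [_ xr]]].
  by move: xe; rewrite /next_event xoo.
by have [e2 [+ _ _]] := next_eventP xr; rewrite xe => -[->] ->.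
Qed.

Lemma residual_dstep p c e e' : next_event (cstate c) = Some e ->
  residual (cstate (dstep p c)) e' =
  if e' == e then mean_clock e * draw_clock p e (count c e)
  else residual (cstate c) e' -
       (if enabled N (cstate c) e' then residual (cstate c) e else 0).
Proof.
move=> ce; rewrite (dstepE p (next_event_fin ce) ce) residual_dfire residual_elapse.
by case: e ce.
Qed.

Lemma count_dstep p c e : count (dstep p c) e =
  (count c e + (next_event (cstate c) == Some e))%N.
Proof.
case E : (next_event (cstate c)) => [e'|].
  rewrite (dstepE p (next_event_fin E) E) count_dfire eq_sym.
  by congr addn; case: e E.
rewrite addn0; move: E; rewrite /dstep /next_event.
by case: time_to_next.
Qed.

(** The departure stands on the left so that no truncated subtraction remains. The one in [dfire] is
    exact, because a class in service has at least one job. *)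
Lemma Zc_dstep p c k : (Zc (cstate (dstep p c)) k +
  (next_event (cstate c) == Some (inr k)) = Zc (cstate c) k +
  (if next_event (cstate c) is Some e then draw_jobs p e (count c e) k else 0))%N.
Proof.
case E : (next_event (cstate c)) => [e|].
  rewrite (dstepE p (next_event_fin E) E) Zc_dfire /=.
  rewrite [Zc (elapse _ _ _) k]/Zc /= -/(Zc _ k).
  have -> : count (Config (elapse N (residual (cstate c) e) (cstate c)) (narr c)
       (nsrv c)) e = count c e by case: e E.
  have kZ : ((inr k == e) <= Zc (cstate c) k)%N.
    case: eqP => //= ke; move: (next_event_enabled E); rewrite -ke /=.
    by case/andP.
  have ekE : (Some e == Some (inr k)) = (inr k == e) by rewrite eq_sym.
  by rewrite ekE addnAC subnK.
rewrite !addn0; move: E; rewrite /dstep /next_event.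
by case: time_to_next.
Qed.

Definition index_valid (e : event) : bool :=
  if e is inl k then k \in external N else true.

Definition draws_ge0 (p : draws) : Prop :=
  forall e i, index_valid e -> 0 <= draw_clock p e i.

Lemma mean_clock_gt0 e : index_valid e -> 0 < mean_clock e.
Proof.
case: e => k /= ke; last exact: mean_service_gt0.
by rewrite invr_gt0; exact: arrival_rate_gt0.
Qed.

Lemma enabled_valid x e : enabled N x e -> index_valid e.
Proof. by case: e. Qed.

Lemma state_space_residual x e : state_space N x -> 0 <= residual x e.
Proof. by case=> H1 [H2 _]; case: e. Qed.

Lemma state_space_time_to_next x : state_space N x -> (0 <= time_to_next N x)%E.
Proof.
move=> Sx; case: (time_to_nextP x) => [->//|[e [_ ->]]].
by rewrite lee_fin state_space_residual.
Qed.

Lemma state_space_dstep p c : draws_ge0 p ->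
  state_space N (cstate c) -> state_space N (cstate (dstep p c)).
Proof.
move=> p0 Sc; case E : (next_event (cstate c)) => [e|]; last first.
  by move: E; rewrite /dstep /next_event; case: time_to_next.
have H e' : 0 <= residual (cstate (dstep p c)) e'.
  rewrite (residual_dstep p _ E); case: eqP => _.
    rewrite mulr_ge0//.
      exact/ltW/mean_clock_gt0/(enabled_valid (next_event_enabled E)).
    by apply: p0; exact/enabled_valid/(next_event_enabled E).
  case: ifPn => ce; last by rewrite subr0; exact: state_space_residual.
  rewrite subr_ge0 -lee_fin -(next_event_fin E); exact: time_to_next_le.
split; first by move=> k; exact: (H (inl k)).
split; first by move=> k; exact: (H (inr k)).
move=> k kE.
rewrite -[LHS]/(residual _ (inl k)) (residual_dstep p _ E) /=.
rewrite (negbTE kE) subr0; case: eqP => [ke|_].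
  by move: (next_event_enabled E); rewrite -ke /= (negbTE kE).
by case: Sc => _ [_]; exact.
Qed.

Lemma state_space_dchain p x n : draws_ge0 p ->
  state_space N x -> state_space N (cstate (dchain p x n)).
Proof. by move=> p0 Sx; elim: n => //= n; exact: state_space_dstep. Qed.

Lemma depochS p x n : (depoch p x n.+1 =
  depoch p x n + time_to_next N (cstate (dchain p x n)))%E.
Proof. by rewrite /depoch big_ord_recr. Qed.

Lemma depoch0 p x : depoch p x 0 = 0%E.
Proof. by rewrite /depoch big_ord0. Qed.

Lemma depoch_ge0 p x n : draws_ge0 p -> state_space N x -> (0 <= depoch p x n)%E.
Proof.
move=> p0 Sx; rewrite /depoch sume_ge0// => i _.
exact/state_space_time_to_next/state_space_dchain.
Qed.

Lemma depoch_le p x m n : draws_ge0 p -> state_space N x -> (m <= n)%N ->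
  (depoch p x m <= depoch p x n)%E.
Proof.
move=> p0 Sx; elim: n => [|n IHn]; first by rewrite leqn0 => /eqP ->.
rewrite leq_eqVlt => /predU1P[->//|/IHn/le_trans]; apply.
rewrite depochS leeDl//; exact/state_space_time_to_next/state_space_dchain.
Qed.

(** * Joint measurability of the chain in the values read and the initial state *)

Section Measurability.
Context {d : measure_display} {T : measurableType d}.

Definition measurable_config (c : T -> config) : Prop :=
  [/\ measurable_fun [set: T] (fun t => cstate (c t)),
      forall k, discrete_fun (fun t => narr (c t) k) &
      forall k, discrete_fun (fun t => nsrv (c t) k)].

Definition measurable_draws (p : T -> draws) : Prop :=
  [/\ forall k i, measurable_fun [set: T] (fun t => draw_arr (p t) k i),
      forall k i, measurable_fun [set: T] (fun t => draw_srv (p t) k i) &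
      forall k i, measurable_fun [set: T] (fun t => draw_rte (p t) k i)].

Section State.
Variable x : T -> state.
Hypothesis mx : measurable_fun [set: T] x.

Lemma discrete_jobs : discrete_fun (fun t => (x t).1.1).
Proof.
apply: discrete_fun_tuple; apply: (measurableT_comp measurable_fst).
exact: (measurableT_comp measurable_fst).
Qed.

Lemma discrete_Zc k : discrete_fun (fun t => Zc (x t) k).
Proof. exact: (discrete_fun_comp (fun z => tnth z k) discrete_jobs). Qed.

Lemma discrete_enabled e : discrete_fun (fun t => enabled N (x t) e).
Proof.
(* Being enabled depends on the job counts alone, so the clocks may be filled with zeros. *)
exact: (discrete_fun_comp
  (fun z => enabled N (z, [tuple 0 | k < K], [tuple 0 | k < K]) e) discrete_jobs).
Qed.

Lemma measurable_residual e : measurable_fun [set: T] (fun t => residual (x t) e).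
Proof.
case: e => k; apply: (measurableT_comp (@measurable_tnth _ _ _ k)).
  by apply: (measurableT_comp measurable_snd); exact: (measurableT_comp measurable_fst).
exact: (measurableT_comp measurable_snd).
Qed.

Lemma measurable_time_to_next :
  measurable_fun [set: T] ((fun t => time_to_next N (x t)) : T -> \bar R).
Proof.
rewrite /time_to_next; elim: (index_enum _) => [|e s IHs].
  by under eq_fun do rewrite big_nil; exact: measurable_cst.
under eq_fun do rewrite big_cons.
pose F (b : bool) t := (if b then Order.min (residual (x t) e)%:E
  (\big[Order.min/+oo%E]_(j <- s | enabled N (x t) j) (residual (x t) j)%:E)
  else (\big[Order.min/+oo%E]_(j <- s | enabled N (x t) j) (residual (x t) j)%:E)).
apply: (@measurable_fun_glue _ _ _ _ _ _ F (discrete_enabled e)).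
case; last exact: IHs.
apply: measurable_mine => //; apply/measurable_EFinP; exact: measurable_residual.
Qed.

(** The tie rule is an arbitrary function, but it only sees the job counts and the finite set of due
    events, a pair with countably many values. *)
Lemma discrete_next_event : discrete_fun (fun t => next_event (x t)).
Proof.
have mf : discrete_fun (fun t => time_to_next N (x t) \is a fin_num).
  apply: discrete_fun_bool; apply: (measurable_fun_bool true) => //.
  exact: (emeasurable_fin_num measurableT measurable_time_to_next).
have md : discrete_fun (fun t => due N (x t)).
  apply: discrete_fun_finset => e.
  apply: discrete_fun_comp2; first exact: discrete_enabled.
  apply: discrete_fun_bool; apply: measurable_fun_eqe.
    by apply/measurable_EFinP; exact: measurable_residual.
  exact: measurable_time_to_next.
pose F (b : bool) (z : K.-tuple nat * {set event}) :=
  if b then Some (tie z.1 z.2) else None.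
have := discrete_fun_comp2 F mf (discrete_fun_pair discrete_jobs md).
rewrite (_ : (fun t => _) = (fun t => next_event (x t)))//.
apply/funext => t; rewrite /F /next_event /=.
case: (time_to_nextP (x t)) => [->//|[e [_ ->]]]//.
Qed.

Lemma measurable_elapse (r : T -> R) : measurable_fun [set: T] r ->
  measurable_fun [set: T] (fun t => elapse N (r t) (x t)).
Proof.
move=> mr; apply: measurable_fun_pair => /=; first apply: measurable_fun_pair => /=.
- apply: (measurableT_comp measurable_fst).
  exact: (measurableT_comp measurable_fst).
- apply: measurable_fun_tuple => k; case: (k \in external N).
    by apply: measurable_funB => //; exact: (measurable_residual (inl k)).
  exact: (measurable_residual (inl k)).
- apply: measurable_fun_tuple => k.
  pose F (b : bool) t := if b then Rsrv (x t) k - r t else Rsrv (x t) k.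
  apply: (@measurable_fun_glue _ _ _ _ _ _ F (discrete_enabled (inr k))).
  have mk := measurable_residual (inr k).
  by case => //; exact: measurable_funB.
Qed.
End State.

Lemma measurable_draw_count (d' : measure_display) (U : measurableType d')
    (f : nat -> T -> U) (h : T -> nat) :
  (forall i, measurable_fun [set: T] (f i)) -> discrete_fun h ->
  measurable_fun [set: T] (fun t => f (h t) t).
Proof. by move=> mf mh; exact: (@measurable_fun_glue _ _ _ _ _ _ f mh). Qed.

Lemma measurable_dfire (p : T -> draws) (c : T -> config) e :
  measurable_draws p -> measurable_config c ->
  measurable_config (fun t => dfire (p t) e (c t)).
Proof.
move=> [pa ps pr] [mx ma ms].
have mR e1 := measurable_residual mx e1.
case: e => k; split => //=.
- apply: measurable_fun_pair => /=; first apply: measurable_fun_pair => /=.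
  + apply: measurable_fun_tuple => l; apply: discrete_fun_measurable_nat.
    exact: (discrete_fun_comp (fun z => (z + (l == k))%N) (discrete_Zc mx l)).
  + apply: measurable_fun_tuple => l; case: (l == k); last exact: (mR (inl l)).
    apply: measurable_funM; first exact: measurable_cst.
    exact: (measurable_draw_count (f := fun i t => draw_arr (p t) k i)).
  + exact: (measurableT_comp measurable_snd).
- by move=> l; apply: (discrete_fun_comp (fun z => (z + (l == k))%N)).
- apply: measurable_fun_pair => /=; first apply: measurable_fun_pair => /=.
  + apply: measurable_fun_tuple => l; apply: measurable_fun_addn.
      apply: discrete_fun_measurable_nat.
      exact: (discrete_fun_comp (fun z => (z - (l == k))%N) (discrete_Zc mx l)).
    apply: (measurable_draw_count (f := fun i t => tnth (draw_rte (p t) k i) l)) => // i.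
    exact: (measurableT_comp (@measurable_tnth _ _ _ l)).
  + apply: (measurableT_comp measurable_snd).
    exact: (measurableT_comp measurable_fst).
  + apply: measurable_fun_tuple => l; case: (l == k); last exact: (mR (inr l)).
    apply: measurable_funM; first exact: measurable_cst.
    exact: (measurable_draw_count (f := fun i t => draw_srv (p t) k i)).
- by move=> l; apply: (discrete_fun_comp (fun z => (z + (l == k))%N)).
Qed.

Lemma measurable_dstep (p : T -> draws) (c : T -> config) :
  measurable_draws p -> measurable_config c ->
  measurable_config (fun t => dstep (p t) (c t)).
Proof.
move=> mp mc; have [mx ma ms] := mc.
have mne := discrete_next_event mx.
pose F (o : option event) t := if o is Some e then
  dfire (p t) e (Config (elapse N (fine (time_to_next N (cstate (c t)))) (cstate (c t)))
    (narr (c t)) (nsrv (c t))) else c t.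
rewrite (_ : (fun t => _) = (fun t => F (next_event (cstate (c t))) t)); last first.
  apply/funext => t; rewrite /F /dstep /next_event.
  by case: (time_to_nextP (cstate (c t))) => [->|[e [_ ->]]].
have mF o : measurable_config (F o).
  case: o => [e|//]; apply: measurable_dfire => //; split => //=.
  apply: measurable_elapse => //; apply: (measurableT_comp (fine_measurable _)) => //.
  exact: measurable_time_to_next.
split.
- apply: (@measurable_fun_glue _ _ _ _ _ _ (fun o t => cstate (F o t)) mne) => o.
  by have [] := mF o.
- move=> k; apply: (@discrete_fun_glue _ _ _ _ _ (fun o t => narr (F o t) k) mne) => o.
  by have [] := mF o.
- move=> k; apply: (@discrete_fun_glue _ _ _ _ _ (fun o t => nsrv (F o t) k) mne) => o.
  by have [] := mF o.
Qed.

Lemma measurable_dchain (p : T -> draws) (x : T -> state) n :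
  measurable_draws p -> measurable_fun [set: T] x ->
  measurable_config (fun t => dchain (p t) (x t) n).
Proof.
move=> mp mx; elim: n => [|n IHn] /=; last exact: measurable_dstep.
by split=> [|k|k] //; exact: discrete_fun_cst.
Qed.

Lemma measurable_depoch (p : T -> draws) (x : T -> state) n :
  measurable_draws p -> measurable_fun [set: T] x ->
  measurable_fun [set: T] ((fun t => depoch (p t) (x t) n) : T -> \bar R).
Proof.
move=> mp mx; apply: emeasurable_sum => i _.
by apply: measurable_time_to_next; have [] := measurable_dchain i mp mx.
Qed.

Lemma discrete_count (c : T -> config) e : measurable_config c ->
  discrete_fun (fun t => count (c t) e).
Proof. by case: e => k [_ ma ms] /=; [exact: ma|exact: ms]. Qed.

End Measurability.
End Chain.

Arguments draws : clear implicits.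
Arguments count_dstep {R J K} N {tie}.
Arguments Zc_dstep {R J K} N {tie}.

(** * Independence of the values not yet read *)

Section Independence.
Context {d : measure_display} {Omega : measurableType d} {R : realType}
  (P : probability Omega R) (I : eqType) (D : set I) (G : I -> set_system Omega).
Hypothesis mG : forall i, G i `<=` measurable.
Hypothesis GT : forall i, G i setT.
Hypothesis GI : forall i, setI_closed (G i).
Hypothesis indG : mutually_independent P D G.

(** Dynkin's argument: the finite intersections [H] avoiding the index [j] form a pi-system, on
    which the finite measures B -> P(B & A) and B -> P(A) P(B) agree. *)
Lemma mutually_independent_others (j : I) (A B : set Omega) : D j -> G j A ->
  <<s \bigcup_(i in [set i | D i /\ i != j]) G i >> B ->
  P (A `&` B) = (P A * P B)%E.
Proof.
move=> Dj GA GB.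
pose H := [set B | exists s F, [/\ uniq s, j \notin s,
  (forall i, i \in s -> D i /\ G i (F i)) &
  B = \bigcap_(i in [set` s]) F i]].
have mA := mG GA.
have mH : H `<=` measurable.
  move=> _ [s [F [_ _ sF ->]]].
  by apply: fin_bigcap_measurable => // i /= /sF[_]; exact: mG.
have HI : setI_closed H.
  move=> _ _ [s1 [F1 [u1 j1 sF1 ->]]] [s2 [F2 [u2 j2 sF2 ->]]].
  exists (undup (s1 ++ s2)), (fun i => (if i \in s1 then F1 i else setT) `&`
    (if i \in s2 then F2 i else setT)); split.
  - exact: undup_uniq.
  - by rewrite mem_undup mem_cat negb_or j1.
  - move=> i; rewrite mem_undup mem_cat => is12; split.
      by case/orP: is12 => [/sF1[]|/sF2[]].
    by apply: GI; case: ifPn => // iin; do [by case: (sF1 _ iin) | by case: (sF2 _ iin)].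
  - apply/seteqP; split => [w [H1 H2] i _|w H12].
      by split; case: ifPn => // iin; do [exact: H1 | exact: H2].
    have H12' i : i \in s1 ++ s2 -> ((if i \in s1 then F1 i else setT) `&`
        (if i \in s2 then F2 i else setT)) w.
      by move=> is12; apply: H12; rewrite /= mem_undup.
    split=> i /= iin.
      by have := H12' i; rewrite mem_cat iin => /(_ isT)[].
    by have := H12' i; rewrite mem_cat iin orbT => /(_ isT)[].
have pA0 : (0 <= fine (P A)) by rewrite fine_ge0.
have PAE : P A = (fine (P A))%:E by rewrite fineK// fin_num_measure.
pose m1 := mrestr P mA; pose m2 := mscale (NngNum pA0) P.
have HT : H setT.
  by exists [::], (fun=> setT); split => //; rewrite bigcap_set_type; apply/seteqP; split.
suff : m1 B = m2 B by rewrite /m1 /m2 /mrestr /mscale/= setIC fineK// fin_num_measure.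
apply: (g_sigma_algebra_measure_unique H mH (fun=> setT)) => //.
- by rewrite bigcup_const//; exists 0%N.
- move=> _ [s [F [us js sF ->]]]; change (P (\bigcap_(i in [set` s]) F i `&` A) =
    (fine (P A))%:E * P (\bigcap_(i in [set` s]) F i))%E; rewrite -PAE.
  (* Intersecting with [A] amounts to adding [j], absent from [s], to the finite family, so that
     mutual independence applies to [j :: s]. *)
  have -> : \bigcap_(i in [set` s]) F i `&` A =
     \bigcap_(i in [set` j :: s]) (fun i => if i == j then A else F i) i.
    apply/seteqP; split => [w [Fw Aw] i /=|w Fw].
      by rewrite inE; case: eqP => // _ /= /Fw.
    split=> [i /= iin|].
      have := Fw i; rewrite /= inE iin orbT; case: eqP => [ij|_]; last exact.
      by move: js; rewrite -ij iin.
    by have := Fw j; rewrite /= inE eqxx; exact.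
  rewrite indG/= ?js//; last first.
    move=> i; rewrite inE; case: eqP => [->//|_] /=; exact: sF.
  rewrite big_cons eqxx; congr (_ * _)%E; rewrite indG//.
  rewrite big_seq [RHS]big_seq; apply: eq_bigr => i iin.
  by case: eqP => // ij; move: js; rewrite -ij iin.
- move=> k; change (P (setT `&` A) < +oo)%E; rewrite setTI.
  by rewrite (le_lt_trans (probability_le1 _ mA))// ltry.
move: B GB; apply: smallest_sub; first exact: smallest_sigma_algebra.
move=> C [i [Di ij] GC]; apply: sub_sigma_algebra.
exists [:: i], (fun=> C); split => //; first by rewrite inE eq_sym.
  by move=> l; rewrite inE => /eqP ->.
by apply/seteqP; split => [w Cw l _ //|w]; apply; rewrite /= inE.
Qed.

End Independence.

(** * Events decided before a given primitive is read *)

Section Masking.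
Context {R : realType} {J K : nat} (N : network R J K) (tie : tie_rule K).
Hypothesis htie : tie_rule_ok tie.
Local Notation event := (@event K).

(** Arrival sequences of classes without external arrivals are exempt from the comparison, as no
    step reads them. *)
Definition draws_agree (j : @prim_index K) (p q : draws R K) : Prop :=
  (forall e i, index_valid N e -> (inl e, i) != j ->
     draw_clock p e i = draw_clock q e i) /\
  (forall k i, (inr k, i) != j -> draw_rte p k i = draw_rte q k i).

(** The event that reads primitive [j]. A service completion reads two of them at once: the next
    service time and the routing vector. *)
Definition index_event (j : @prim_index K) : event :=
  match j.1 with inl e => e | inr k => inr k end.

Lemma draws_agree_sym j p q : draws_agree j p q -> draws_agree j q p.
Proof. by case=> H1 H2; split => [e i ve ij|k i ij]; rewrite ?H1 ?H2. Qed.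

(** Numbering starts at 0, so [j] is read by the step that raises the count of its event from [j.2]
    to [j.2 + 1]. A count of at most [j.2] after the step thus means that [j] is still unread. *)
Lemma dstep_agree j p q c : draws_agree j p q ->
  (count (dstep N tie p c) (index_event j) <= j.2)%N ->
  dstep N tie p c = dstep N tie q c.
Proof.
move=> [pq1 pq2] cj; case E : (next_event N tie (cstate c)) => [e|]; last first.
  by move: E; rewrite /dstep /next_event; case: time_to_next.
have ve := enabled_valid (next_event_enabled htie E).
rewrite !(dstepE _ (next_event_fin htie E) E).
have ne : forall jj : @prim_index K, index_event jj = e -> jj.2 = count c e -> jj != j.
  move=> jj je j2; apply: contraTneq cj => jjj; rewrite -jjj.
  by rewrite (count_dstep N htie) je E eqxx j2 addn1 ltnn.
case: e E ve ne => k /= E ve ne.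
  by have := pq1 (inl k) (narr c k) ve; rewrite /= => -> //; exact: ne.
have := pq1 (inr k) (nsrv c k) ve; rewrite /= => -> //; last exact: ne.
by have := pq2 k (nsrv c k); rewrite /= => -> //; exact: ne.
Qed.

Lemma count_dchain_le p x m n e : (m <= n)%N ->
  (count (dchain N tie p x m) e <= count (dchain N tie p x n) e)%N.
Proof.
move=> /subnK <-; elim: (n - m)%N => //= l IHl; apply: (leq_trans IHl).
by rewrite (count_dstep N htie) leq_addr.
Qed.

Lemma dchain_agree j p q x n : draws_agree j p q ->
  (count (dchain N tie p x n) (index_event j) <= j.2)%N ->
  dchain N tie p x n = dchain N tie q x n.
Proof.
move=> pq; elim: n => //= n IHn cj.
have cnj : (count (dchain N tie p x n) (index_event j) <= j.2)%N.
  by apply: leq_trans cj; rewrite (count_dstep N htie) leq_addr.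
by rewrite (dstep_agree pq)// IHn.
Qed.

(** The epoch [n.+1] only involves the states up to number [n], that is, before the event at this
    epoch reads anything. Hence the bound on the count is needed at [n] only. *)
Lemma depoch_agree j p q x n : draws_agree j p q ->
  (count (dchain N tie p x n) (index_event j) <= j.2)%N ->
  depoch N tie p x n.+1 = depoch N tie q x n.+1.
Proof.
move=> pq cj; apply: eq_bigr => i _; rewrite (dchain_agree pq)//.
by apply: leq_trans cj; apply: count_dchain_le; rewrite -ltnS.
Qed.

(** The index [i] is fixed here: whether this happens is decided before value number [i] of [e] is
    read, which makes it independent of that value. *)
Definition nth_event_is (p : draws R K) (x : state R K) (n : nat) (e : event)
    (i : nat) : Prop :=
  [/\ (depoch N tie p x n.+1 <= 1)%E,
      next_event N tie (cstate (dchain N tie p x n)) = Some e &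
      count (dchain N tie p x n) e = i].

Lemma nth_event_is_agree j p q x n : draws_agree j p q ->
  nth_event_is p x n (index_event j) j.2 -> nth_event_is q x n (index_event j) j.2.
Proof.
move=> pq [p1 pn pc]; have cj : (count (dchain N tie p x n) (index_event j) <= j.2)%N.
  by rewrite pc.
by rewrite /nth_event_is -(dchain_agree pq cj) -(depoch_agree pq cj).
Qed.

Lemma measurable_nth_event_is (d : measure_display) (T : measurableType d)
    (p : T -> draws R K) (x : T -> state R K) n e i :
  measurable_draws p -> measurable_fun [set: T] x ->
  measurable [set t | nth_event_is (p t) (x t) n e i].
Proof.
move=> mp mx; have [mc _ _] := measurable_dchain N tie n mp mx.
have mE := measurable_depoch N tie n.+1 mp mx.
rewrite [X in measurable X](_ : _ =
  [set t | (depoch N tie (p t) (x t) n.+1 <= 1)%E] `&`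
  ([set t | next_event N tie (cstate (dchain N tie (p t) (x t) n)) = Some e] `&`
   [set t | count (dchain N tie (p t) (x t) n) e = i])); last first.
  by apply/seteqP; split => t; [case|case=> ? []].
apply: measurableI.
  rewrite -[X in measurable X]setTI.
  exact: (measurable_lee measurableT mE (@measurable_cst _ _ _ _ _ 1%E)).
apply: measurableI; first exact: (discrete_next_event N tie mc [set (Some e)]).
exact: (discrete_count e (measurable_dchain N tie n mp mx) [set i]).
Qed.

Section Primitives.
Context {d : measure_display} {Omega : measurableType d}
  {P : probability Omega R} (W : primitives N P).
Hypothesis hW : primitives_ok W.

Definition prim_draws (w : Omega) : draws R K :=
  Draws (fun k i => arr W k i w) (fun k i => srv W k i w) (fun k i => rte W k i w).

Lemma prim_draws_ge0 w : draws_ge0 N (prim_draws w).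
Proof.
case=> k i /= ki; [exact: (arr_ge0 hW)|exact: (srv_ge0 hW)].
Qed.

Lemma measurable_prim_draws : measurable_draws prim_draws.
Proof. by split => k i; exact: measurable_funP. Qed.

(* Run on these values, the chain is measurable with respect to the primitives
   other than [j], and it is unchanged as long as [j] has not been read. *)
Definition masked_draws (j : @prim_index K) (w : Omega) : draws R K :=
  Draws (fun k i => if (k \in external N) && ((inl (inl k), i) != j)
                    then arr W k i w else 0)
        (fun k i => if (inl (inr k), i) != j then srv W k i w else 0)
        (fun k i => if (inr k, i) != j then rte W k i w else [tuple 0%N | l < K]).

Lemma masked_draws_agree j w : draws_agree j (prim_draws w) (masked_draws j w).
Proof.
split=> [[k|k] i /= ve ij|k i /= ->//]; first by rewrite ve ij.
by rewrite ij.
Qed.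

Definition other_sigma (j : @prim_index K) : set_system Omega :=
  \bigcup_(i in [set i | prim_valid N i /\ i != j]) prim_sigma W i.

Lemma measurable_masked_draws j :
  @measurable_draws R K _ (g_sigma_algebraType (other_sigma j)) (masked_draws j).
Proof.
have mask d' (U : measurableType d') (b : bool) (u : U) (f : Omega -> U) :
    (b -> forall A, measurable A -> other_sigma j (setT `&` f @^-1` A)) ->
    @measurable_fun _ _ (g_sigma_algebraType (other_sigma j)) U setT
      (fun w => if b then f w else u).
  case: b => [/(_ isT) mf|_]; last exact: measurable_cst.
  by move=> _ A mA; apply: sub_sigma_algebra; exact: mf.
split=> k i; apply: mask.
- by move=> /andP[kE ij] A mA; exists (inl (inl k), i) => //; exists A.
- by move=> ij A mA; exists (inl (inr k), i) => //; exists A.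
- by move=> ij A mA; exists (inr k, i) => //; exists A.
Qed.

(** The masked run decides the same set, since the two runs agree while [j] is unread, and the
    masked run is measurable for the other primitives. *)
Lemma nth_event_is_other j x n :
  <<s other_sigma j >> [set w | nth_event_is (prim_draws w) x n (index_event j) j.2].
Proof.
have := @measurable_nth_event_is _ (g_sigma_algebraType (other_sigma j))
  (masked_draws j) (fun=> x) n (index_event j) j.2 (measurable_masked_draws j)
  (measurable_cst _).
congr (_ _); apply/seteqP; split => w; apply: nth_event_is_agree.
  exact/draws_agree_sym/masked_draws_agree.
exact/masked_draws_agree.
Qed.

Lemma nth_event_is_indep j x n A : prim_valid N j -> prim_sigma W j A ->
  (P ([set w | nth_event_is (prim_draws w) x n (index_event j) j.2] `&` A) =
   P [set w | nth_event_is (prim_draws w) x n (index_event j) j.2] * P A)%E.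
Proof.
move=> vj jA; rewrite setIC muleC.
apply: (mutually_independent_others _ _ _ (prim_independent hW) vj jA).
- move=> [[[k|k]|k] i] _ [B mB <-]; exact: measurable_funP.
- move=> [[[k|k]|k] i]; exists setT => //=; rewrite ?preimage_setT setTI//.
- move=> [[[k|k]|k] i] _ _ [B mB <-] [C mC <-]; rewrite !setTI -preimage_setI;
  (exists (B `&` C); [exact: measurableI|by rewrite setTI]).
- exact: nth_event_is_other.
Qed.

End Primitives.
End Masking.

(** * Integration lemmas *)

Lemma ge0_integral_mrestr (d : measure_display) (T : measurableType d)
    (R : realType) (mu : {measure set T -> \bar R}) (D : set T)
    (mD : measurable D) (f : T -> \bar R) :
  measurable_fun [set: T] f -> (forall t, 0 <= f t)%E ->
  (\int[mrestr mu mD]_t f t = \int[mu]_(t in D) f t)%E.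
Proof.
move=> mf f0.
have mCD : measurable (~` D) by exact: measurableC.
rewrite [LHS](ge0_negligible_integral mCD)//; last first.
  by rewrite -[LHS]/(mu (~` D `&` D)) setICl measure0.
rewrite setTD setCK; apply: eq_measure_integral => A mA AD.
by rewrite -[LHS]/(mu (A `&` D)) setIidl.
Qed.

(** Restricting the product measure to [B] and pushing it forward by [T] gives the law of [T0] times
    the mass of [B]. This is checked section by section, because independence is available for a
    fixed initial state [x]. *)
Lemma ge0_integral_indep (R : realType) (d1 d2 d3 : measure_display)
    (S : measurableType d1) (Omega : measurableType d2) (V : measurableType d3)
    (pi : probability S R) (P : probability Omega R) (B : set (S * Omega))
    (T T0 : {RV P >-> V}) (F : V -> \bar R) :
  measurable B -> measurable_fun [set: V] F -> (forall v, 0 <= F v)%E ->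
  (forall x A, measurable A ->
     P (xsection B x `&` T @^-1` A) = P (xsection B x) * P (T0 @^-1` A))%E ->
  (\int[pi \x P]_(z in B) F (T z.2) =
   (pi \x P) B * \int[P]_w F (T0 w))%E.
Proof.
move=> mB mF F0 indep.
have mTs : measurable_fun [set: S * Omega] (fun z => T z.2).
  exact: (measurableT_comp (measurable_funP T)).
have mFT0 : measurable_fun [set: Omega] (fun w => F (T0 w)).
  exact: (measurableT_comp mF (measurable_funP T0)).
rewrite -(ge0_integral_mrestr (pi \x P)%E mB)//; last exact: (measurableT_comp mF).
transitivity (\int[pushforward (mrestr (pi \x P)%E mB) (fun z => T z.2)]_v F v)%E.
  by rewrite ge0_integral_pushforward.
have MB0 : 0 <= fine ((pi \x P)%E B) by rewrite fine_ge0.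
have MBE : (fine ((pi \x P)%E B))%:E = (pi \x P)%E B.
  by rewrite fineK; [|exact: (fin_num_measure (pi \x P : probability _ _)%E B mB)].
transitivity (\int[mscale (NngNum MB0) (distribution P T0)]_v F v)%E; last first.
  by rewrite ge0_integral_mscale// ge0_integral_distribution//= MBE.
apply: eq_measure_integral => A mA _.
rewrite -[RHS]/((fine ((pi \x P)%E B))%:E * P (T0 @^-1` A))%E MBE.
rewrite -[LHS]/((pi \x P)%E ((fun z => T z.2) @^-1` A `&` B)).
rewrite /product_measure1 /=.
rewrite -(ge0_integralZr pi)//=; last first.
  exact: measurable_fun_xsection.
apply: eq_integral => x _ /=; rewrite -indep// setIC.
congr (P _); apply/seteqP; split => w /=; rewrite /xsection/= ?inE /=.
  by move=> [].
by move=> [].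
Qed.

(** * Conservation laws without integrability *)

Section Balance.
Context (d : measure_display) (T : measurableType d) (R : realType)
  (mu : probability T R).
Local Open Scope ereal_scope.

Lemma balance_le (U V : T -> R) (A B : T -> \bar R) :
  measurable_fun [set: T] U -> measurable_fun [set: T] V ->
  measurable_fun [set: T] A -> measurable_fun [set: T] B ->
  (forall t, 0 <= U t)%R -> (forall t, 0 <= V t)%R ->
  (forall t, 0 <= A t) -> (forall t, 0 <= B t) ->
  {ae mu, forall t, (U t)%:E + B t = (V t)%:E + A t} ->
  (forall M : nat, \int[mu]_t (Num.min (U t) M%:R)%:E =
                   \int[mu]_t (Num.min (V t) M%:R)%:E) ->
  \int[mu]_t A t <= \int[mu]_t B t.
Proof.
move=> mU mV mA mB U0 V0 A0 B0 UB UV.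
(* This is min(V + A, M) - min(V, M), written so that no extended real is subtracted. *)
pose h (M : nat) t := mine (A t) (Num.max (M%:R - V t) 0)%:E.
have h0 M t : 0 <= h M t by rewrite le_min A0/= lee_fin le_max lexx orbT.
have mh M : measurable_fun [set: T] (h M).
  apply: measurable_mine => //; apply/measurable_EFinP.
  by apply: measurable_maxr => //; exact: measurable_funB.
have hA t : h ^~ t @ \oo --> A t.
  case At : (A t) (A0 t) => [a||]//.
    move=> _; apply: cvg_near_cst; near=> M; rewrite /h At; apply/min_idPl.
    rewrite lee_fin le_max lerBrDr; apply/orP; left; near: M.
    exact: nbhs_infty_ger.
  move=> _; apply/cvgeyPge => y; near=> M; rewrite /h At.
  rewrite (_ : mine _ _ = (Num.max (M%:R - V t) 0)%:E); last first.
    by apply/min_idPr; rewrite leey.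
  rewrite lee_fin le_max lerBrDr; apply/orP; left; near: M.
  exact: nbhs_infty_ger.
have mmin (W : T -> R) (M : nat) : measurable_fun [set: T] W ->
    measurable_fun [set: T] (fun t => (Num.min (W t) M%:R)%:E).
  by move=> mW; apply/measurable_EFinP; exact: measurable_minr.
have hB M : \int[mu]_t h M t <= \int[mu]_t B t.
  have fV : \int[mu]_t (Num.min (V t) M%:R)%:E \is a fin_num.
    rewrite ge0_fin_numE; last first.
      by apply: integral_ge0 => t _; rewrite lee_fin le_min V0 ler0n.
    apply: (@le_lt_trans _ _ (\int[mu]_t (M%:R)%:E)).
      apply: ge0_le_integral => //.
      - by move=> t _; rewrite lee_fin le_min V0 ler0n.
      - exact: mmin.
      - by move=> t _; rewrite lee_fin ge_min lexx orbT.
    by rewrite integral_cst//= probability_setT mule1 ltry.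
  (* The integral of min(V, M) is finite and equals that of min(U, M), so it may be added on both
     sides. *)
  rewrite -(leeD2lE _ _ fV) -[in leRHS]UV -!ge0_integralD//; first last.
  - exact: mmin.
  - by move=> t _; rewrite lee_fin le_min V0 ler0n.
  - exact: mmin.
  - by move=> t _; rewrite lee_fin le_min U0 ler0n.
  apply: ae_ge0_le_integral => //.
  - by move=> t _; rewrite adde_ge0// lee_fin le_min V0 ler0n.
  - by apply: emeasurable_funD => //; exact: mmin.
  - by move=> t _; rewrite adde_ge0// lee_fin le_min U0 ler0n.
  - by apply: emeasurable_funD => //; exact: mmin.
  apply: filterS UB => t UBt _.
  (* Pointwise, min(V, M) + h <= min(V + A, M) = min(U + B, M) <= min(U, M) + B. *)
  apply: (@le_trans _ _ (mine ((U t)%:E + B t) M%:R%:E)); last first.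
    have [UM|MU] := leP (U t) M%:R; first by rewrite ge_min lexx.
    by rewrite ge_min leeDl// orbT.
  rewrite UBt le_min; apply/andP; split.
    by apply: leeD; [rewrite lee_fin ge_min lexx|rewrite /h ge_min lexx].
  apply: (@le_trans _ _ ((Num.min (V t) M%:R)%:E + (Num.max (M%:R - V t) 0)%:E)).
    by apply: leeD2l; rewrite /h ge_min lexx orbT.
  rewrite -EFinD lee_fin; have [VM|MV] := leP (V t) M%:R.
    by rewrite max_l ?subr_ge0// subrKC.
  by rewrite max_r ?addr0// subr_le0 ltW.
have -> : \int[mu]_t A t = limn (fun M => \int[mu]_t h M t).
  rewrite -monotone_convergence//.
    by apply: eq_integral => t _; apply/esym/cvg_lim.
  move=> t _ M M' MM'; rewrite /h le_min ge_min lexx/= ge_min; apply/orP; right.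
  by rewrite lee_fin ge_max !le_max lexx orbT andbT lerD2r ler_nat MM'.
apply: lime_le; last by apply: nearW.
apply: ereal_nondecreasing_is_cvgn => M M' MM'; apply: ge0_le_integral => // t _.
rewrite /h le_min ge_min lexx/= ge_min; apply/orP; right.
by rewrite lee_fin ge_max !le_max lexx orbT andbT lerD2r ler_nat MM'.
Unshelve. all: by end_near.
Qed.

(* No integrability is required: [mu] integrates min(U, M) and min(V, M) to the
   same finite number, and min(V + A, M) - min(V, M) increases to A. *)
Lemma balance (U V : T -> R) (A B : T -> \bar R) :
  measurable_fun [set: T] U -> measurable_fun [set: T] V ->
  measurable_fun [set: T] A -> measurable_fun [set: T] B ->
  (forall t, 0 <= U t)%R -> (forall t, 0 <= V t)%R ->
  (forall t, 0 <= A t) -> (forall t, 0 <= B t) ->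
  {ae mu, forall t, (U t)%:E + B t = (V t)%:E + A t} ->
  (forall M : nat, \int[mu]_t (Num.min (U t) M%:R)%:E =
                   \int[mu]_t (Num.min (V t) M%:R)%:E) ->
  \int[mu]_t A t = \int[mu]_t B t.
Proof.
move=> mU mV mA mB U0 V0 A0 B0 UB UV; apply/eqP; rewrite eq_le.
rewrite (balance_le mU mV mA mB)//= (balance_le mV mU mB mA)//.
by apply: filterS UB => t ->.
Qed.

End Balance.

(** * Conservation along a path *)

Section Path.
Context {R : realType} {J K : nat} (N : network R J K) (tie : tie_rule K).
Local Notation event := (@event K).

(** The counterpart of [state_at] for detached values. On [prim_draws W w] the two are convertible,
    which is how stationarity reaches it. *)
Definition dstate_at (p : draws R K) (x : state R K) (t : R) (y : state R K) : Prop :=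
  exists n r, [/\ depoch N tie p x n = r%:E, r <= t,
    (t%:E < depoch N tie p x n.+1)%E &
    y = elapse N (t - r) (cstate (dchain N tie p x n))].

Lemma measurable_dstate_at (d : measure_display) (T : measurableType d)
    (p : T -> draws R K) (x : T -> state R K) (t : T -> R) (B : set (state R K)) :
  measurable_draws p -> measurable_fun [set: T] x -> measurable_fun [set: T] t ->
  measurable B ->
  measurable [set s | exists2 y, dstate_at (p s) (x s) (t s) y & B y].
Proof.
move=> mp mx mt mB.
pose E n s := depoch N tie (p s) (x s) n.
have mE n : measurable_fun [set: T] (E n) by exact: measurable_depoch.
pose Y n s := elapse N (t s - fine (E n s)) (cstate (dchain N tie (p s) (x s) n)).
have mY n : measurable_fun [set: T] (Y n).
  apply: measurable_elapse; first by case: (measurable_dchain N tie n mp mx).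
  apply: measurable_funB => //; apply: (measurableT_comp (fine_measurable _)) => //.
rewrite [X in measurable X](_ : _ = \bigcup_n
  ((setT `&` [set s | E n s \is a fin_num]) `&` (setT `&` [set s | (E n s <= (t s)%:E)%E])
   `&` (setT `&` [set s | ((t s)%:E < E n.+1 s)%E]) `&` (setT `&` Y n @^-1` B))); last first.
  apply/seteqP; split => [s [y [n [r [En rt tn yE]]] By]|s [n _]].
    exists n => //=; rewrite /E /= En lee_fin rt; split; last first.
      by rewrite /Y /E En /= -yE.
    by [].
  move=> [[[[_ /= Efin] [_ /= Et]] [_ /= tE]] [_ /= YB]].
  exists (Y n s) => //; exists n, (fine (E n s)).
  by split; rewrite ?fineK// -lee_fin fineK.
apply: bigcupT_measurable => n; apply: measurableI; last exact: mY.
apply: measurableI; last first.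
  by apply: measurable_lte => //; exact/measurable_EFinP.
apply: measurableI; last first.
  by apply: measurable_lee => //; exact/measurable_EFinP.
exact: emeasurable_fin_num.
Qed.

Hypothesis htie : tie_rule_ok tie.
Variables (p : draws R K) (x : state R K).
Hypothesis (p0 : draws_ge0 N p) (Sx : state_space N x).
Local Notation chain_ := (dchain N tie p x).
Local Notation epoch_ := (depoch N tie p x).

(** Epochs are nondecreasing, so at most one [n] has its epoch at or before [t] and the next one
    strictly after [t], even when several events share an epoch. *)
Lemma dstate_at_inj n r t y : epoch_ n = r%:E -> r <= t ->
  (t%:E < epoch_ n.+1)%E ->
  dstate_at p x t y <-> y = elapse N (t - r) (cstate (chain_ n)).
Proof.
move=> En rt tE; split=> [[n' [r' [En' r't tE' ->]]]|->]; last by exists n, r.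
suff nn' : n = n' by move: En'; rewrite -nn' En => -[->].
have lt_le a b ra : epoch_ b = ra%:E -> ra <= t -> (t%:E < epoch_ a.+1)%E -> (b <= a)%N.
  move=> Eb rat ta; rewrite leqNgt; apply/negP => ab.
  have := depoch_le htie p0 Sx ab; rewrite Eb leNgt => /negP; apply.
  by apply: le_lt_trans ta; rewrite lee_fin.
by apply/eqP; rewrite eqn_leq (lt_le _ _ _ En rt tE') (lt_le _ _ _ En' r't tE).
Qed.

Lemma dstate_atP t y : dstate_at p x t y -> exists n r,
  [/\ epoch_ n = r%:E, r <= t, (t%:E < epoch_ n.+1)%E,
      0 <= r & y = elapse N (t - r) (cstate (chain_ n))].
Proof.
move=> [n [r [En rt tE yE]]]; exists n, r; split => //.
by rewrite -lee_fin -En; exact: depoch_ge0.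
Qed.

(** Events from number [n] on occur after [t], so the series is a finite sum. Series are what gets
    integrated, finite sums are what the induction along a path handles. *)
Lemma sum_happened (e : event) (n : nat) (r t : R) (g : nat -> R) :
  epoch_ n = r%:E -> r <= t -> (t%:E < epoch_ n.+1)%E ->
  (\sum_(i <oo) (if `[< (epoch_ i.+1 <= t%:E)%E /\
     next_event N tie (cstate (chain_ i)) = Some e >] then (g i)%:E else 0))%E =
  (\sum_(i < n) (if next_event N tie (cstate (chain_ i)) == Some e then g i else 0))%:E.
Proof.
move=> En rt tE; rewrite -sumEFin; apply/cvg_lim => //.
apply: cvg_near_cst; near=> m.
rewrite big_mkord -(big_mkord xpredT (fun i => if `[< (epoch_ i.+1 <= t%:E)%E /\
   next_event N tie (cstate (chain_ i)) = Some e >] then (g i)%:E else 0%E)).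
rewrite (@big_cat_nat _ _ _ n)//=; last by near: m; exact: nbhs_infty_ge.
rewrite [X in (_ + X)%E]big_nat_cond [X in (_ + X)%E]big1 ?adde0; last first.
  move=> i /andP[/andP[ni _] _].
  case: asboolP => // -[Ei _]; have := lt_le_trans tE (depoch_le htie p0 Sx (ni : n.+1 <= i.+1)%N).
  by rewrite ltNge Ei.
rewrite big_mkord; apply: eq_bigr => i _.
rewrite (_ : `[< _ >] = (next_event N tie (cstate (chain_ i)) == Some e)).
  by case: ifP.
apply/asboolP/eqP => [[]//|ie]; split => //.
by apply: (le_trans (depoch_le htie p0 Sx (ltn_ord i))); rewrite En lee_fin.
Unshelve. all: by end_near.
Qed.

Section Clock.
Variables (e : event) (A : set R) (f : R -> R).
Hypothesis mA : measurable A.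
Hypothesis f0 : f 0 = 0.
(* [f] plays the role of the antiderivative of the indicator function of [A],
   along a clock running down from [r] for a duration [h]. *)
Hypothesis leb_f : forall a r h, 0 <= h -> h <= r ->
  (lebesgue_measure [set s | (a <= s < a + h)%R /\ A (r - (s - a))%R] = (f r - f (r - h))%:E)%E.

Definition clock_set : set (state R K) := [set y | enabled N y e /\ A (residual y e)].

(** The integral of f'(R_e) over the time [e] is enabled, f' being the indicator function of [A]. *)
Definition occupation (t : R) : \bar R :=
  lebesgue_measure [set s | 0 <= s < t /\ exists2 y, dstate_at p x s y & clock_set y].

Lemma measurable_clock_set : measurable clock_set.
Proof.
rewrite [X in measurable X](_ : _ = [set y | enabled N y e] `&`
   (setT `&` (fun y => residual y e) @^-1` A)); last first.
  by apply/seteqP; split => y; [case=> ? ?; split|case=> ? [_ ?]].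
apply: measurableI; first exact: (@discrete_enabled _ _ _ N _ _ idfun (@measurable_id _ _ _) e).
exact: (@measurable_residual _ _ _ _ idfun (@measurable_id _ _ _) e).
Qed.

(** Between two epochs the clock of [e] either runs down at unit speed or is frozen, so [leb_f]
    evaluates the time it spends in [A]. *)
Lemma occupation_split n r u : epoch_ n = r%:E -> 0 <= r -> r <= u ->
  (u%:E <= epoch_ n.+1)%E ->
  occupation u = (occupation r + (f (residual (cstate (chain_ n)) e) -
    f (residual (cstate (chain_ n)) e -
       (if enabled N (cstate (chain_ n)) e then u - r else 0)))%:E)%E.
Proof.
move=> En r0 ru uE; set c := cstate (chain_ n).
have mQ : measurable [set s | exists2 y, dstate_at p x s y & clock_set y].
  apply: (@measurable_dstate_at _ (measurableTypeR R) (fun=> p) (fun=> x) idfun).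
  - by split=> k i; exact: measurable_cst.
  - exact: measurable_cst.
  - exact: measurable_id.
  - exact: measurable_clock_set.
have mS (a b : R) : measurable
    [set s | a <= s < b /\ exists2 y, dstate_at p x s y & clock_set y].
  rewrite [X in measurable X](_ : _ = `[a, b[ `&`
    [set s | exists2 y, dstate_at p x s y & clock_set y]); last first.
    by apply/seteqP; split => s [+ ?]; rewrite /= in_itv.
  exact: measurableI.
have Q s : r <= s -> s < u -> (exists2 y, dstate_at p x s y & clock_set y) <->
    enabled N c e /\ A (residual c e - (s - r)).
  move=> rs su; have sE : (s%:E < epoch_ n.+1)%E by apply: lt_le_trans uE; rewrite lte_fin.
  have cE : clock_set (elapse N (s - r) c) <->
      enabled N c e /\ A (residual c e - (s - r)).
    rewrite /clock_set /= enabled_elapse residual_elapse.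
    by case: (enabled N c e); split=> -[].
  split=> [[y /(dstate_at_inj _ En rs sE) ->]|/cE cs]; first by move/cE.
  by exists (elapse N (s - r) c) => //; exact/(dstate_at_inj _ En rs sE).
rewrite /occupation [X in lebesgue_measure X](_ : _ =
  [set s | 0 <= s < r /\ exists2 y, dstate_at p x s y & clock_set y] `|`
  [set s | r <= s < u /\ exists2 y, dstate_at p x s y & clock_set y]); last first.
  apply/seteqP; split => [s [/andP[s0 su] Qs]|s].
    have [sr|rs] := ltP s r; [left|right]; split => //=.
      by rewrite s0.
    by rewrite rs su.
  move=> [] [/andP[s1 s2] Qs]; split=> //; first by rewrite s1 (lt_le_trans s2).
  by rewrite (le_trans r0 s1).
rewrite measureU; [|exact: mS|exact: mS|]; last first.
  by apply/disjoints_subset => s [/andP[_ sr] _] [/andP[rs _] _]; move: sr; rewrite ltNge rs.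
congr (_ + _)%E; case: ifPn => ce.
  rewrite -(leb_f r); last 2 first.
  - by rewrite subr_ge0.
  (* An enabled clock lasts at least until the next epoch, hence the duration [u - r] does not
     exceed it. *)
  - rewrite lerBlDl -lee_fin EFinD; apply: (le_trans uE); rewrite depochS En.
    by rewrite leeD2l//; exact: time_to_next_le.
  congr (lebesgue_measure _); rewrite subrKC; apply/seteqP; split => s [/andP[s1 s2]].
    by move=> /(Q _ s1 s2)[_ ?]; rewrite /= s1 s2.
  by move=> As; split; [rewrite s1|exact/(Q _ s1 s2)].
have -> : [set s | r <= s < u /\ exists2 y, dstate_at p x s y & clock_set y] = set0;
  last by rewrite measure0 subr0 subrr.
apply/seteqP; split => // s [/andP[s1 s2] /(Q _ s1 s2)[]].
by rewrite (negbTE ce).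
Qed.

Definition clock_jumps (n : nat) : R :=
  \sum_(i < n) (if next_event N tie (cstate (chain_ i)) == Some e
    then f (mean_clock N e * draw_clock p e (count (chain_ i) e)) else 0).

Lemma clock_balance_at n r u : epoch_ n = r%:E -> r <= u ->
  (u%:E <= epoch_ n.+1)%E ->
  ((f (residual x e) + clock_jumps n)%:E =
   (f (residual (cstate (chain_ n)) e -
       (if enabled N (cstate (chain_ n)) e then (u - r)%R else 0%R)))%:E + occupation u)%E.
Proof.
move=> En ru uE; have r0 : 0 <= r by rewrite -lee_fin -En; exact: depoch_ge0.
rewrite (occupation_split En)// addeCA -EFinD subrKC.
suff -> : ((f (residual x e) + clock_jumps n)%:E =
   (f (residual (cstate (chain_ n)) e))%:E + occupation r)%E by rewrite addeC.
elim: n r {u ru uE} En r0 => [|n IHn] r En r0.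
  rewrite /clock_jumps big_ord0 addr0 /=.
  have -> : r = 0 by move: En; rewrite depoch0 => -[].
  rewrite /occupation [X in lebesgue_measure X](_ : _ = set0) ?measure0 ?adde0//.
  by apply/seteqP; split => // s [/andP[s0 s1]]; move: s1; rewrite ltNge s0.
have [r' En'] : exists r', epoch_ n = r'%:E.
  have := depoch_ge0 htie n p0 Sx.
  have := depoch_le htie p0 Sx (leqnSn n); rewrite En.
  by case: (epoch_ n) => // r' _ _; exists r'.
have [h th] : exists h, time_to_next N (cstate (chain_ n)) = h%:E.
  have := state_space_time_to_next (state_space_dchain htie n p0 Sx).
  by move: En; rewrite depochS En'; case: (time_to_next _ _) => // h _ _; exists h.
have rE : r = r' + h by move: En; rewrite depochS En' th => -[].
have h0 : 0 <= h.
  by have := state_space_time_to_next (state_space_dchain htie n p0 Sx); rewrite th lee_fin.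
have r'0 : 0 <= r' by rewrite -lee_fin -En'; exact: depoch_ge0.
rewrite /clock_jumps big_ord_recr/= -/(clock_jumps n) addrA EFinD (IHn r')//.
rewrite (@occupation_split n r' r)//; [|by rewrite rE lerDl|by rewrite En].
have [e' [Ne' _ ce' re']] := next_eventP htie th.
rewrite (residual_dstep htie _ _ Ne') Ne' rE.
rewrite (_ : r' + h - r' = h) ?re'; last by rewrite addrC addKr.
have -> : (Some e' == Some e) = (e == e') by rewrite eq_sym.
case: eqP => [ee'|_].
  (* When [e] itself happens its clock has reached 0, where [f] vanishes, and the value of [f] at
     the fresh clock is the new term of [clock_jumps]. *)
  by rewrite ee' ce' re' subrr f0 subr0 [RHS]addeC; congr (_ + _)%E; rewrite addeC.
by rewrite adde0 addeCA -EFinD subrKC addeC.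
Qed.

Lemma clock_balance y : dstate_at p x 1 y ->
  ((f (residual x e))%:E +
   \sum_(i <oo) (if `[< (epoch_ i.+1 <= 1)%E /\
     next_event N tie (cstate (chain_ i)) = Some e >]
     then (f (mean_clock N e * draw_clock p e (count (chain_ i) e)))%:E else 0) =
   (f (residual y e))%:E + occupation 1)%E.
Proof.
move=> /dstate_atP[n [r [En r1 tE r0 ->]]].
pose g i := f (mean_clock N e * draw_clock p e (count (chain_ i) e)).
rewrite (sum_happened _ g En r1 tE).
rewrite -EFinD (clock_balance_at En r1 (ltW tE)) residual_elapse//.
Qed.

End Clock.

Lemma jobs_balance_at n k :
  (Zc (cstate (chain_ n)) k + \sum_(i < n)
     (next_event N tie (cstate (chain_ i)) == Some (inr k)) =
   Zc x k + \sum_(i < n) \sum_(e : event)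
     if next_event N tie (cstate (chain_ i)) == Some e
     then draw_jobs p e (count (chain_ i) e) k else 0)%N.
Proof.
elim: n => [|n IHn]; first by rewrite !big_ord0.
rewrite !big_ord_recr/= addnCA (Zc_dstep N htie) addnA.
rewrite [X in (X + _ = _)%N]addnC IHn -addnA; congr (_ + (_ + _))%N.
case: next_event => [e|]; last by rewrite big1.
rewrite (bigD1 e)//= eqxx big1 ?addn0// => e' e'e.
have -> : (Some e == Some e') = (e' == e) by rewrite eq_sym.
by rewrite (negbTE e'e).
Qed.

Lemma jobs_balance y k : dstate_at p x 1 y ->
  (((Zc y k)%:R)%:E + \sum_(i <oo) (if `[< (epoch_ i.+1 <= 1)%E /\
     next_event N tie (cstate (chain_ i)) = Some (inr k) >] then 1%:E else 0) =
   ((Zc x k)%:R)%:E + \sum_(e : event) \sum_(i <oo)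
     (if `[< (epoch_ i.+1 <= 1)%E /\ next_event N tie (cstate (chain_ i)) = Some e >]
      then (((draw_jobs p e (count (chain_ i) e) k)%:R : R)%:E) else 0))%E.
Proof.
move=> /dstate_atP[n [r [En r1 tE r0 ->]]].
rewrite (sum_happened _ (fun=> 1) En r1 tE).
under [in RHS]eq_bigr do
  rewrite (sum_happened _ (fun i => (draw_jobs p _ (count (chain_ i) _) k)%:R) En r1 tE).
rewrite sumEFin -!EFinD; congr (_%:E).
have := congr1 (fun m : nat => m%:R : R) (jobs_balance_at n k).
rewrite !natrD natr_sum => H.
rewrite [Zc (elapse _ _ _) k]/Zc /= -/(Zc _ k).
rewrite (eq_bigr (fun i : 'I_n => (next_event N tie (cstate (chain_ i)) == Some (inr k))%:R));
  last by move=> i _; case: ifP.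
rewrite H; congr (_ + _); rewrite exchange_big/= natr_sum; apply: eq_bigr => e _.
rewrite natr_sum; apply: eq_bigr => i _.
by case: ifP.
Qed.

End Path.

Lemma dstate_at_unique (R : realType) (J K : nat) (N : network R J K)
    (tie : tie_rule K) (p : draws R K) (x : state R K) (t : R) (y y' : state R K) :
  tie_rule_ok tie -> draws_ge0 N p -> state_space N x ->
  dstate_at N tie p x t y -> dstate_at N tie p x t y' -> y = y'.
Proof.
move=> htie p0 Sx [n [r [En rt tE ->]]].
by move/(dstate_at_inj htie p0 Sx _ En rt tE) => ->.
Qed.

(** * Lebesgue integrals on the line *)

Section Lebesgue.
Context {R : realType}.

Lemma lebesgue_itvco (a b : R) : a <= b ->
  lebesgue_measure `[a, b[ = (b - a)%:E.
Proof.
rewrite le_eqVlt => /predU1P[->|ab].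
  by rewrite set_itvco0 measure0 subrr.
by rewrite lebesgue_measure_itv/= lte_fin ab EFinB.
Qed.

(** Here f is the identity on nonnegative clocks, cut off at 0 because [clock_rate] wants it
    nonnegative on the whole line. *)
Lemma lebesgue_shift_setT (a r h : R) : 0 <= h -> h <= r ->
  (lebesgue_measure [set s | (a <= s < a + h)%R /\ [set: R] (r - (s - a))%R] =
   (Num.max r 0 - Num.max (r - h) 0)%:E)%E.
Proof.
move=> h0 hr; have r0 : 0 <= r := le_trans h0 hr.
rewrite !max_l ?subr_ge0// (_ : [set _ | _] = `[a, a + h[%classic).
  by rewrite lebesgue_itvco ?lerDl//; congr (_%:E); lra.
by apply/seteqP; split => s /=; rewrite in_itv/=; [case|].
Qed.

(** On nonnegative clocks this f is min(r, c) if c >= 0, and 0 if c < 0. Negative [c] are included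
    so that all rays ]-oo, c[ are covered, as they will serve as a generating pi-system. *)
Lemma lebesgue_shift_lt (c a r h : R) : 0 <= h -> h <= r ->
  (lebesgue_measure [set s | (a <= s < a + h)%R /\ `]-oo, c[%classic (r - (s - a))%R] =
   (Num.min (Num.max r 0) (Num.max c 0) -
    Num.min (Num.max (r - h) 0) (Num.max c 0))%:E)%E.
Proof.
move=> h0 hr; have r0 : 0 <= r := le_trans h0 hr; set A := [set s | _ /\ _].
rewrite (max_l r0) [Num.max (r - h) 0]max_l ?subr_ge0//.
have [cr|cr] := leP c (r - h).
  rewrite (_ : A = set0) ?measure0; last first.
    by apply/seteqP; split => // s; rewrite /A /= in_itv/= => -[/andP[s1 s2]]; lra.
  by rewrite !min_r ?subrr// ge_max; apply/andP; split; lra.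
have c0 : 0 <= c by lra.
rewrite (max_l c0) [Num.min (r - h) c]min_l ?ltW//.
have [rc|rc] := ltP r c.
  rewrite (_ : A = `[a, a + h[%classic); last first.
    apply/seteqP; split => s; rewrite /A /= !in_itv/=.
      move=> [s1 s2]. exact: s1.
    by move=> s12; split => //; lra.
  by rewrite lebesgue_itvco ?lerDl//; congr (_%:E); lra.
(* Now c lies between r - h and r, and the clock is below c from time a + r - c on. *)
rewrite (_ : A = `]a + r - c, a + h[%classic); last first.
  apply/seteqP; split => s; rewrite /A /= !in_itv/=.
    by move=> [/andP[s1 s2] s3]; apply/andP; split; lra.
  by move=> /andP[s1 s2]; split; [apply/andP; split; lra|lra].
rewrite lebesgue_measure_itv/= lte_fin ifT; last by lra.
by rewrite -EFinB; congr (_%:E); lra.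
Qed.

Lemma integral_power (n : nat) (a b : R) : a <= b ->
  (\int[lebesgue_measure]_(s in `[a, b[) (s ^+ n)%:E =
   (n.+1%:R^-1 * (b ^+ n.+1 - a ^+ n.+1))%:E)%E.
Proof.
rewrite le_eqVlt => /predU1P[->|ab].
  by rewrite set_itvco0 integral_set0 subrr mulr0.
rewrite integral_itv_bndo_bndc; last first.
  apply/measurable_EFinP; apply: measurable_funTS; exact: exprn_measurable.
pose F (s : R) := n.+1%:R^-1 * s ^+ n.+1.
have cF : continuous F.
  move=> s; apply: cvgM; [exact: cvg_cst|exact: exprn_continuous].
have dX (s : R) : derivable (@GRing.exp R ^~ n.+1) s 1 by exact: exprn_derivable.
rewrite (@continuous_FTC2 _ (fun s => s ^+ n) F)//.
- by rewrite -EFinB mulrBr.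
- by apply/continuous_subspaceT => s; exact: exprn_continuous.
- split=> [s _||].
  + have := @derivableZ R R R (@GRing.exp R ^~ n.+1) n.+1%:R^-1 s 1 (dX s); exact.
  + by apply: cvg_at_right_filter; exact: cF.
  + by apply: cvg_at_left_filter; exact: cF.
- move=> s _; rewrite /F derive1Ml// exp_derive1.
  by rewrite /GRing.scale/= mulrA mulVf// mul1r.
Qed.

End Lebesgue.

(** * Stationarity and the event rates *)

Section Stationary.
Context {R : realType} {J K : nat} (N : network R J K) (tie : tie_rule K).
Hypothesis htie : tie_rule_ok tie.
Context {d : measure_display} {Omega : measurableType d}
  {P : probability Omega R} (W : primitives N P).
Hypothesis hW : primitives_ok W.
Variable pi : probability (state R K) R.
Hypothesis hpi : stationary W tie pi.
Local Notation event := (@event K).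
Local Notation T := (state R K * Omega)%type.
Local Notation draws_ z := (prim_draws W z.2).
Local Notation chain_ z := (dchain N tie (prim_draws W z.2) z.1).
Local Notation epoch_ z := (depoch N tie (prim_draws W z.2) z.1).
Local Notation M := (pi \x P : probability T R)%E.

Definition happens (n : nat) (e : event) : set T :=
  [set z | (epoch_ z n.+1 <= 1)%E /\ next_event N tie (cstate (chain_ z n)) = Some e].

(* The expected number of events [e] in one unit of time. *)
Definition event_rate (e : event) : \bar R := (\sum_(n <oo) M (happens n e))%E.

Let mdraws : measurable_draws (fun z : T => draws_ z).
Proof.
have [ma ms mr] := measurable_prim_draws W.
by split => k i; [move: (ma k i)|move: (ms k i)|move: (mr k i)] => H;
  exact: (measurableT_comp H measurable_snd).
Qed.

(** Splitting by the index read replaces a value at a random index by a fixed random variable on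
    each piece. *)
Lemma happensE n e : happens n e =
  \bigcup_i [set z | nth_event_is N tie (draws_ z) z.1 n e i].
Proof.
apply/seteqP; split => [z [zn ze]|z [i _ [zn ze _]]//].
by exists (count (chain_ z n) e).
Qed.

Lemma measurable_nth_event n e i :
  measurable [set z : T | nth_event_is N tie (draws_ z) z.1 n e i].
Proof. exact: measurable_nth_event_is. Qed.

Lemma measurable_happens n e : measurable (happens n e).
Proof.
by rewrite happensE; apply: bigcupT_measurable => i; exact: measurable_nth_event.
Qed.

Section Drawn.
Context {d' : measure_display} {V : measurableType d'}.
Variables (e : event) (D : nat -> Omega -> V) (F : V -> \bar R).
Hypothesis mD : forall i, measurable_fun [set: Omega] (D i).
Hypothesis mF : measurable_fun [set: V] F.

Lemma measurable_drawn n :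
  measurable_fun [set: T] (fun z : T => F (D (count (chain_ z n) e) z.2)).
Proof.
apply: (measurableT_comp mF).
apply: (@measurable_draw_count _ _ _ _ (fun i (z : T) => D i z.2)) => //.
  by move=> i; exact: (measurableT_comp (mD i)).
by apply: discrete_count; exact: measurable_dchain.
Qed.

Lemma happens_patch n (f : T -> \bar R) :
  (fun z : T => if `[< happens n e z >] then f z else 0%E) = f \_ (happens n e).
Proof.
apply/funext => z; rewrite patchE.
by congr (if _ then _ else _); apply/asboolP/idP; rewrite inE.
Qed.

Lemma measurable_drawn_sum : (forall v, 0 <= F v)%E ->
  measurable_fun [set: T] ((fun z => \sum_(n <oo) (if `[< happens n e z >]
     then F (D (count (chain_ z n) e) z.2) else 0))%E : T -> \bar R).
Proof.
move=> F0; apply: ge0_emeasurable_sum; first by move=> n z _ _; case: ifP.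
move=> n _; rewrite happens_patch; apply/(measurable_restrictT _ _).1.
  exact: measurable_happens.
by apply: measurable_funTS; exact: measurable_drawn.
Qed.

End Drawn.

(* Wald's identity: the value read at the i-th event [e] is independent of when
   that event happens. *)
Lemma jump_integral (e : event) (d' : measure_display) (V : measurableType d')
    (D : nat -> {RV P >-> V}) (F : V -> \bar R) (r : R) (j : nat -> @prim_index K) :
  (forall i, index_event (j i) = e) -> (forall i, (j i).2 = i) ->
  (forall i, prim_valid N (j i)) ->
  (forall i A, measurable A -> prim_sigma W (j i) (D i @^-1` A)) ->
  (forall i A, measurable A -> P (D i @^-1` A) = P (D 0%N @^-1` A)) ->
  measurable_fun [set: V] F -> (forall v, 0 <= F v)%E ->
  (\int[P]_w F (D 0%N w) = r%:E)%E ->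
  (\int[M]_z (\sum_(n <oo) (if `[< happens n e z >]
     then F (D (count (chain_ z n) e) z.2) else 0)) =
   event_rate e * r%:E)%E.
Proof.
move=> je j2 jv jD Did mF F0 Fr.
have mDF n := measurable_drawn e (fun i => measurable_funP (D i)) mF n.
have fE n := happens_patch e n (fun z => F (D (count (chain_ z n) e) z.2)).
rewrite integral_nneseries//; last 2 first.
- move=> n; rewrite fE; apply/(measurable_restrictT _ _).1.
    exact: measurable_happens.
  exact: measurable_funTS.
- by move=> n z _; case: ifP.
rewrite /event_rate muleC -nneseriesZl; last first.
  by move=> n _; exact: measure_ge0.
apply: eq_eseriesr => n _; rewrite muleC fE -integral_mkcond.
rewrite happensE ge0_integral_bigcup//; last 3 first.
- by move=> i; exact: measurable_nth_event.
- exact: measurable_funTS.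
- move=> i i' _ _ [z [[_ _ <-] [_ _ <-]]]//.
rewrite measure_semi_bigcup; first last.
- by apply: bigcupT_measurable => i; exact: measurable_nth_event.
- by move=> i i' _ _ [z [[_ _ <-] [_ _ <-]]].
- by move=> i; exact: measurable_nth_event.
rewrite muleC -nneseriesZl; last first.
  by move=> i _; exact: measure_ge0.
apply: eq_eseriesr => i _; rewrite muleC -Fr.
transitivity (\int[M]_(z in [set z | nth_event_is N tie (draws_ z) z.1 n e i])
   F (D i z.2))%E.
  by apply: eq_integral => z; rewrite inE => -[_ _ ->].
apply: ge0_integral_indep => //; first exact: measurable_nth_event.
move=> x A mA; rewrite -(Did i)//.
have -> : xsection [set z : T | nth_event_is N tie (draws_ z) z.1 n e i] x =
    [set w | nth_event_is N tie (prim_draws W w) x n (index_event (j i)) (j i).2].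
  by apply/seteqP; split => w; rewrite /xsection/= inE/= je j2.
by apply: nth_event_is_indep => //; exact: jD.
Qed.

(** * The state at time 1 and its law *)

Lemma measurable_state_space : measurable (state_space N).
Proof.
have mR e := @measurable_residual R K _ (state R K) idfun (@measurable_id _ _ _) e.
have mge e : measurable [set x : state R K | 0 <= residual x e].
  rewrite [X in measurable X](_ : _ = setT `&` (fun x => residual x e) @^-1` `[0, +oo[).
    exact: mR.
  by apply/seteqP; split => x /=; rewrite in_itv/= andbT; [|case].
have meq e : measurable [set x : state R K | residual x e = 0].
  rewrite [X in measurable X](_ : _ = setT `&` (fun x => residual x e) @^-1` [set 0]).
    exact: mR.
  by apply/seteqP; split => x /=; [|case].
rewrite [X in measurable X](_ : _ =
  \bigcap_(k in [set: 'I_K]) [set x | 0 <= residual x (inl k)] `&`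
  (\bigcap_(k in [set: 'I_K]) [set x | 0 <= residual x (inr k)] `&`
   \bigcap_(k in [set k | k \notin external N]) [set x | residual x (inl k) = 0])).
  by repeat apply: measurableI; apply: fin_bigcap_measurable => // k _.
apply/seteqP; split => [x [H1 [H2 H3]]|x [H1 [H2 H3]]].
  by split; [move=> k _; exact: H1|split => [k _|k]; [exact: H2|exact: H3]].
split; first by move=> k; exact: H1.
by split=> [k|k kE]; [exact: H2|exact: H3].
Qed.

Definition reached (t : R) (B : set (state R K)) : set T :=
  [set z | exists2 y, dstate_at N tie (draws_ z) z.1 t y & B y].

Lemma measurable_reached t B : measurable B -> measurable (reached t B).
Proof.
by move=> mB; apply: measurable_dstate_at => //; exact: measurable_cst.
Qed.

Lemma prob_reached t B : 0 <= t -> measurable B -> M (reached t B) = pi B.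
Proof.
move=> t0 mB; rewrite -(hpi.2 t t0 B mB); apply: eq_integral => x _ /=.
by rewrite /transition /xsection; congr (P _); apply/seteqP; split => w; rewrite /= inE.
Qed.

Lemma prob_initial B : measurable B -> M (B `*` setT) = pi B.
Proof.
move=> mB; transitivity (pi B * P setT)%E; first exact: product_measure1E.
by rewrite probability_setT mule1.
Qed.

Definition good : set T := (state_space N `*` setT) `&` reached 1 setT.

Lemma measurable_good : measurable good.
Proof.
apply: measurableI; last exact: measurable_reached.
by apply: measurableX => //; exact: measurable_state_space.
Qed.

(** Stationarity for the whole state space says that the state at time 1 exists with probability
    one, so non-explosion costs no separate argument. *)
Lemma prob_good_setI X : measurable X -> M (X `&` good) = M X.
Proof.
have full (A B : set T) : measurable A -> measurable B -> M A = 1%E ->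
    M (B `&` A) = M B.
  move=> mA mB A1; apply/eqP; rewrite eq_le le_measure ?inE//=; last exact: measurableI.
  rewrite (measureDI M mB mA).
  apply: (@le_trans _ _ (0 + M (B `&` A))%E); last by rewrite add0e.
  apply: leeD2r; apply: (@le_trans _ _ (M (~` A))).
    apply: le_measure; rewrite ?inE; [exact: measurableD|exact: measurableC|].
    by move=> z [].
  by rewrite (@probability_setC _ _ _ M A mA) A1 subee.
move=> mX; rewrite /good setIA full//.
- rewrite full//; first by apply: measurableX => //; exact: measurable_state_space.
  by rewrite prob_initial ?hpi.1//; exact: measurable_state_space.
- exact: measurable_reached.
- by apply: measurableI => //; apply: measurableX => //; exact: measurable_state_space.
- by rewrite prob_reached// probability_setT.
Qed.

Lemma ae_good : {ae M, forall z, good z}.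
Proof.
exists (~` good); split => //; first exact: measurableC measurable_good.
by rewrite -prob_good_setI ?setICl ?measure0//; exact: measurableC measurable_good.
Qed.

(* The state at time 1; the initial state on the null set where it is undefined. *)
Definition final (z : T) : state R K :=
  xget z.1 [set y | good z /\ dstate_at N tie (draws_ z) z.1 1 y].

Lemma finalP z : good z -> dstate_at N tie (draws_ z) z.1 1 (final z).
Proof.
move=> gz; rewrite /final; case: xgetP => [y _ [_ //]|ny].
by case: (gz) => _ [y zy _]; exfalso; apply: (ny y).
Qed.

(** The choice made by [xget] is measurable because the state at time 1 is unique: on [good] the
    preimage is [reached 1 B]. *)
Lemma final_preimage B : final @^-1` B =
  (good `&` reached 1 B) `|` (~` good `&` (B `*` setT)).
Proof.
apply/seteqP; split => z /=.
  move=> Bz; have [gz|gz] := pselect (good z).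
    by left; split => //; exists (final z) => //; exact: finalP.
  right; split => //; split => //=; move: Bz; rewrite /final; case: xgetP => //.
  by move=> y _ [].
move=> [[gz [y zy By]]|[gz [/= Bz _]]].
  have [[Sz _] _] := gz.
  by rewrite (dstate_at_unique htie (prim_draws_ge0 hW z.2) Sz (finalP gz) zy).
by rewrite /final; case: xgetP => // y _ [].
Qed.

Lemma measurable_final : measurable_fun [set: T] final.
Proof.
move=> _ B mB; rewrite setTI final_preimage; apply: measurableU; apply: measurableI.
- exact: measurable_good.
- exact: measurable_reached.
- exact: measurableC measurable_good.
- exact: measurableX.
Qed.

Lemma prob_final B : measurable B -> M (final @^-1` B) = pi B.
Proof.
move=> mB; rewrite -(@prob_reached 1)// -[RHS]prob_good_setI; last first.
  exact: measurable_reached.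
rewrite -prob_good_setI; last first.
  by rewrite -[X in measurable X]setTI; exact: measurable_final.
congr (M _); rewrite final_preimage; apply/seteqP; split => z.
  by move=> [[[gz zB]|[ngz _]] gz'].
by move=> [zB gz]; split => //; left.
Qed.

Lemma integral_final (phi : state R K -> \bar R) :
  measurable_fun [set: state R K] phi -> (forall x, 0 <= phi x)%E ->
  (\int[M]_z phi (final z) = \int[M]_z phi z.1)%E.
Proof.
move=> mphi phi0.
have law (Y : T -> state R K) : measurable_fun [set: T] Y ->
    (forall B, measurable B -> M (Y @^-1` B) = pi B) ->
    (\int[M]_z phi (Y z) = \int[pi]_x phi x)%E.
  move=> mY Ypi; pose F : {mfun T >-> state R K} :=
    HB.pack Y (isMeasurableFun.Build _ _ _ _ _ mY).
  rewrite -[LHS](ge0_integral_distribution (P := M) F)//.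
  by apply: eq_measure_integral => B mB _; exact: Ypi.
rewrite (law _ measurable_final prob_final) (law _ measurable_fst)// => B mB.
by rewrite -prob_initial//; congr (M _); apply/seteqP; split => z //= [].
Qed.

(** * Expected occupation times *)

Definition occupied (e : event) (A : set R) : set (T * R) :=
  [set u | 0 <= u.2 < 1 /\
     exists2 y, dstate_at N tie (draws_ u.1) u.1.1 u.2 y & clock_set N e A y].

Lemma occupation_xsection e A z :
  occupation N tie (draws_ z) z.1 e A 1 =
  lebesgue_measure (xsection (occupied e A) z).
Proof.
by congr (lebesgue_measure _); apply/seteqP; split => s; rewrite /xsection/= inE.
Qed.

Lemma measurable_occupied e A : measurable A ->
  measurable (occupied e A : set (T * measurableTypeR R)).
Proof.
move=> mA; apply: measurableI.
  rewrite [X in measurable X](_ : _ = setT `&` snd @^-1` `[0, 1[%classic).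
    exact: measurable_snd.
  by apply/seteqP; split => u /=; rewrite in_itv/=; [|case].
apply: (@measurable_dstate_at _ _ _ N tie _ (T * measurableTypeR R)%type
  (fun u => draws_ u.1) (fun u => u.1.1) snd) => //.
- have [ma ms mr] := mdraws.
  by split => k i; [move: (ma k i)|move: (ms k i)|move: (mr k i)] => H;
    exact: (measurableT_comp H measurable_fst).
- exact: (measurableT_comp measurable_fst measurable_fst).
- exact: measurable_clock_set.
Qed.

Lemma measurable_occupation e A : measurable A ->
  measurable_fun [set: T] ((fun z => occupation N tie (draws_ z) z.1 e A 1) : T -> \bar R).
Proof.
move=> mA; under eq_fun do rewrite occupation_xsection.
apply: measurable_fun_xsection; exact: measurable_occupied.
Qed.

(** At each time s in [0, 1[ the state has law [pi], so after Tonelli the integrand is constant in s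
    on an interval of length one. *)
Lemma integral_occupation e A : measurable A ->
  (\int[M]_z occupation N tie (draws_ z) z.1 e A 1 = pi (clock_set N e A))%E.
Proof.
move=> mA; have mC := measurable_clock_set N e mA.
under eq_integral do rewrite occupation_xsection.
have mS := measurable_occupied e mA.
have := indic_fubini_tonelli M lebesgue_measure mS.
rewrite (indic_fubini_tonelli_FE lebesgue_measure mS) => ->.
have GE := indic_fubini_tonelli_GE M mS.
transitivity (\int[lebesgue_measure]_s M (ysection (occupied e A) s))%E.
  by apply: eq_integral => s _; exact: (congr1 (fun g => g s) GE).
transitivity (\int[lebesgue_measure]_s (cst (pi (clock_set N e A)) \_ `[0%R, 1%R[) s)%E.
  apply: eq_integral => s _; rewrite patchE /=; case: ifPn.
    rewrite inE/= in_itv/= => /andP[s0 s1]; rewrite -(prob_reached s0 mC).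
    congr (M _); apply/seteqP; split => z; rewrite /ysection/= inE/=; first by case.
    by move=> zs; split => //; rewrite s0.
  rewrite notin_setE/= in_itv/= => s01; rewrite (_ : ysection _ _ = set0) ?measure0//.
  by apply/seteqP; split => z//; rewrite /ysection/= inE/= => -[].
rewrite -integral_mkcond integral_cst// -[RHS]mule1; congr (_ * _)%E.
by have /= -> := @lebesgue_itvco R 0 1 ler01; rewrite subr0.
Qed.

(** [balance] applied to f(R_e) at times 0 and 1: the occupation is the loss, the values of f at
    fresh clocks are the gain. The mean [r] of the gain per event is a real number, while f(R_e)
    itself need not be integrable. *)
Lemma clock_rate (e : event) (A : set R) (f : R -> R) (r : R) :
  index_valid N e -> measurable A -> measurable_fun [set: R] f ->
  f 0 = 0 -> (forall s, 0 <= f s) ->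
  (forall a s h, 0 <= h -> h <= s ->
     (lebesgue_measure [set u | (a <= u < a + h)%R /\ A (s - (u - a))%R] =
      (f s - f (s - h))%:E)%E) ->
  (\int[P]_w (f (mean_clock N e * draw_clock (prim_draws W w) e 0))%:E = r%:E)%E ->
  pi (clock_set N e A) = (event_rate e * r%:E)%E.
Proof.
move=> ve mA mf f0 fge0 lebf fr.
pose D i : {RV P >-> R} := match e with inl k => arr W k i | inr k => srv W k i end.
have DE i w : draw_clock (prim_draws W w) e i = D i w by rewrite /D; case: (e).
pose F (v : R) := (f (mean_clock N e * v))%:E.
have mF : measurable_fun [set: R] F.
  apply/measurable_EFinP; apply: (measurableT_comp mf).
  by apply: measurable_funM => //; exact: measurable_cst.
have F0 v : (0 <= F v)%E by rewrite lee_fin.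
rewrite -(@jump_integral e _ _ D F r (fun i => (inl e, i)))//; first last.
- by rewrite -fr; apply: eq_integral => w _; rewrite DE.
- move=> i B mB; rewrite /D; case: (e) ve => k ve.
    exact: (arr_id hW ve).
  exact: (srv_id hW).
- move=> i B mB; rewrite /D; case: (e) => k /=; exists B => //; by rewrite setTI.
- by move=> i; rewrite /prim_valid /=; case: (e) ve.
rewrite -integral_occupation//.
have mfr (Y : T -> state R K) : measurable_fun [set: T] Y ->
    measurable_fun [set: T] (fun z => f (residual (Y z) e)).
  by move=> mY; apply: (measurableT_comp mf); exact: measurable_residual.
apply: (@balance _ _ _ M (fun z => f (residual z.1 e))
                         (fun z => f (residual (final z) e))) => //.
- exact: mfr.
- by apply: mfr; exact: measurable_final.
- exact: measurable_occupation.
- exact: (measurable_drawn_sum e (fun i => measurable_funP (D i)) mF F0).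
- by move=> z; apply: nneseries_ge0 => n _; case: ifP.
- apply: filterS ae_good => z gz.
  have [[Sz _] _] := gz.
  have := @clock_balance _ _ _ N tie htie _ _ (prim_draws_ge0 hW z.2) Sz
    e A f mA f0 lebf _ (finalP gz).
  move=> <-; congr (_ + _)%E; apply: eq_eseriesr => n _.
  by rewrite /F -DE.
move=> m; rewrite (integral_final (phi := fun y => (Num.min (f (residual y e)) m%:R)%:E))//.
  apply/measurable_EFinP; apply: measurable_minr => //; apply: (measurableT_comp mf).
  exact: (@measurable_residual _ _ _ _ idfun (@measurable_id _ _ _) e).
by move=> y; rewrite lee_fin le_min fge0 ler0n.
Qed.

(** * Rates of the events *)

Lemma mean_draw_clock e : index_valid N e ->
  (\int[P]_w (Num.max (mean_clock N e * draw_clock (prim_draws W w) e 0) 0)%:E =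
   (mean_clock N e)%:E)%E.
Proof.
move=> ve; have m0 := mean_clock_gt0 ve.
pose D : {RV P >-> R} := match e with inl k => arr W k 0%N | inr k => srv W k 0%N end.
have DE w : draw_clock (prim_draws W w) e 0 = D w by rewrite /D; case: (e).
have D0 w : 0 <= D w by rewrite -DE; exact: (prim_draws_ge0 hW).
have ED : (\int[P]_w (D w)%:E = 1)%E.
  rewrite /D; case: (e) ve => k ve.
    by have := arr_mean hW ve; rewrite unlock.
  by have := srv_mean hW k; rewrite unlock.
transitivity (\int[P]_w ((mean_clock N e)%:E * (D w)%:E))%E.
  by apply: eq_integral => w _; rewrite DE max_l ?EFinM// mulr_ge0// ltW.
rewrite ge0_integralZl_EFin//; last exact: ltW.
- by rewrite ED mule1.
- by move=> w _; rewrite lee_fin.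
- exact/measurable_EFinP.
Qed.

Lemma prob_enabled e : index_valid N e ->
  pi [set y | enabled N y e] = (event_rate e * (mean_clock N e)%:E)%E.
Proof.
move=> ve; rewrite -(@clock_rate e setT (fun s => Num.max s 0) (mean_clock N e))//.
- by congr (pi _); apply/seteqP; split => y; [split|case].
- exact: measurable_maxr.
- by rewrite maxxx.
- by move=> s; rewrite le_max lexx orbT.
- by move=> a s h h0 hs; exact: lebesgue_shift_setT.
- exact: mean_draw_clock.
Qed.

Lemma event_rateE e : index_valid N e ->
  event_rate e = (pi [set y | enabled N y e] * ((mean_clock N e)^-1)%:E)%E.
Proof.
move=> ve; rewrite prob_enabled// -muleA -EFinM mulfV ?mule1//.
by rewrite gt_eqF// mean_clock_gt0.
Qed.

Lemma happens_invalid n e : ~~ index_valid N e -> happens n e = set0.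
Proof.
move=> ve; apply/seteqP; split => // z [_ ze]; move: ve.
by rewrite (enabled_valid (next_event_enabled htie ze)).
Qed.

Lemma event_rate_invalid e : ~~ index_valid N e -> event_rate e = 0%E.
Proof.
by move=> ve; rewrite /event_rate eseries0// => n _ _; rewrite happens_invalid// measure0.
Qed.

(** An external arrival is enabled in every state, so its rate is the inverse of its mean clock. *)
Lemma event_rate_arrival k : event_rate (inl k) = (arrival_rate N k)%:E.
Proof.
have [kE|kE] := boolP (k \in external N); last first.
  by rewrite event_rate_invalid// (arrival_rate_eq0 kE).
rewrite event_rateE//= (_ : [set _ | _] = setT) ?probability_setT ?mul1e ?invrK//.
by apply/seteqP; split.
Qed.

(** A rate is a probability divided by a mean clock. Finiteness lets the traffic equations be solved
    over the reals. *)
Lemma event_rate_fin e : event_rate e \is a fin_num.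
Proof.
have [ve|ve] := boolP (index_valid N e); last by rewrite event_rate_invalid.
rewrite event_rateE// fin_numM// fin_num_measure//.
exact: (@discrete_enabled _ _ _ N _ _ idfun (@measurable_id _ _ _) e).
Qed.

(** Routing vectors are unit vectors, so entry [k] is the indicator of being [unit_vec (Some k)]. *)
Lemma integral_routing l k :
  (\int[P]_w ((tnth (rte W l 0%N w) k)%:R)%:E = (routing W l k)%:E)%E.
Proof.
rewrite mxE; set A := [set w | _].
have mA : measurable A.
  exact: (discrete_fun_tuple (measurable_funP (rte W l 0%N)) [set (unit_vec (Some k))]).
rewrite fineK ?fin_num_measure//.
transitivity (\int[P]_w (\1_A w)%:E)%E; last by rewrite integral_indic// setIT.
apply: eq_integral => w _; congr (_%:E); rewrite indicE.
have [ko ow] := rte_unit hW l 0%N w.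
rewrite ow tnth_mktuple; case: eqP => [kok|kok].
  by rewrite mem_set// /A /= ow kok.
rewrite memNset// /A /= ow => /(congr1 (fun v => tnth v k)).
by rewrite !tnth_mktuple eqxx; case: eqP kok.
Qed.

(** [balance] for the number of class [k] jobs: departures on the left, external arrivals and routed
    jobs on the right. A routed job is weighted by the routing vector read at that completion, hence
    Wald's identity with a routing index. *)
Lemma traffic_equation k : event_rate (inr k) =
  (\sum_(e : event) event_rate e *
     (match e with inl l => (k == l)%:R | inr l => routing W l k end)%:E)%E.
Proof.
(* Counting events is Wald's identity for a constant function; any sequence read at [e] will do as
   [D]. *)
have jump1 (r : R) (e : event) : 0 <= r ->
    (\int[M]_z (\sum_(n <oo) (if `[< happens n e z >] then r%:E else 0)) =
     event_rate e * r%:E)%E.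
  move=> r0; have [ve|ve] := boolP (index_valid N e); last first.
    rewrite event_rate_invalid// mul0e integral0_eq// => z _.
    by rewrite eseries0// => n _ _; rewrite happens_invalid//; case: asboolP.
  pose D i : {RV P >-> R} := match e with inl k => arr W k i | inr k => srv W k i end.
  rewrite -(@jump_integral e _ _ D (fun=> r%:E) r (fun i => (inl e, i)))//.
  - move=> i; rewrite /prim_valid /=; move: ve; clear; case: e => //.
  - move=> i B mB; rewrite /D; case: (e) => k' /=; exists B => //; by rewrite setTI.
  - move=> i B mB; rewrite /D; case: (e) ve => k' ve.
      exact: (arr_id hW ve).
    exact: (srv_id hW).
  - by rewrite integral_cst//= probability_setT mule1.
have mjump1 (r : R) (e : event) : 0 <= r -> measurable_fun [set: T]
    ((fun z => \sum_(n <oo) (if `[< happens n e z >] then r%:E else 0))%E : T -> \bar R).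
  move=> r0; apply: (@measurable_drawn_sum _ R e (fun _ _ => 0) (fun=> r%:E)) => //.
pose S (e : event) (z : T) := (\sum_(n <oo) (if `[< happens n e z >] then
  ((draw_jobs (draws_ z) e (count (chain_ z n) e) k)%:R : R)%:E else 0))%E.
have S0 e z : (0 <= S e z)%E.
  by apply: nneseries_ge0 => n _ _; case: ifP => // _; rewrite lee_fin.
have mtnth : measurable_fun [set: K.-tuple nat] (fun v => ((tnth v k)%:R : R)%:E).
  apply/measurable_EFinP; apply: (measurableT_comp (f := fun i : nat => i%:R : R)) => //.
  exact: measurable_tnth.
have mS e : measurable_fun [set: T] (S e).
  case: e => l; first exact: mjump1.
  exact: (measurable_drawn_sum (inr l) (fun i => measurable_funP (rte W l i)) mtnth).
have IS e : (\int[M]_z S e z = event_rate e *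
     (match e with inl l => (k == l)%:R | inr l => routing W l k end)%:E)%E.
  case: e => l; first exact: jump1.
  rewrite -(@jump_integral (inr l) _ _ (rte W l) (fun v => (tnth v k)%:R%:E) _
    (fun i => (inr l, i)))//.
  - by move=> i B mB; exists B => //; rewrite setTI.
  - by move=> i B mB; exact: (rte_id hW).
  - exact: integral_routing.
rewrite -[LHS]mule1 -(jump1 1 (inr k))//.
rewrite -(eq_bigr _ (fun e _ => IS e)) -ge0_integral_sum//.
have mZ (Y : T -> state R K) : measurable_fun [set: T] Y ->
    measurable_fun [set: T] (fun z => (Zc (Y z) k)%:R : R).
  move=> mY; apply: (measurableT_comp (f := fun i : nat => i%:R : R)) => //.
  exact/discrete_fun_measurable_nat/discrete_Zc.
apply: (@balance _ _ _ M (fun z => (Zc z.1 k)%:R) (fun z => (Zc (final z) k)%:R)) => //.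
- exact: mZ.
- by apply: mZ; exact: measurable_final.
- exact: mjump1.
- exact: emeasurable_sum.
- by move=> z; apply: nneseries_ge0 => n _ _; case: ifP.
- by move=> z; exact: sume_ge0.
- apply: filterS ae_good => z gz.
  have [[Sz _] _] := gz.
  have := jobs_balance htie (prim_draws_ge0 hW z.2) Sz k (finalP gz).
  by move=> ->.
move=> m; rewrite (integral_final (phi := fun y => (Num.min (Zc y k)%:R m%:R)%:E))//.
  apply/measurable_EFinP; apply: measurable_minr => //.
  apply: (measurableT_comp (f := fun i : nat => i%:R : R)) => //.
  apply: discrete_fun_measurable_nat.
  exact: (@discrete_Zc _ _ _ _ idfun (@measurable_id _ _ _) k).
Qed.

(** In vector form the traffic equations read v = lambda + P^T v, and I - P^T is invertible as the
    transpose of I - P. *)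
Lemma event_rate_service k : event_rate (inr k) = (alpha W k ord0)%:E.
Proof.
pose v : 'cV[R]_K := \col_k fine (event_rate (inr k)).
pose lam : 'cV[R]_K := \col_k arrival_rate N k.
have vE l : event_rate (inr l) = (v l ord0)%:E by rewrite mxE fineK ?event_rate_fin.
have vi i : v i ord0 = arrival_rate N i + \sum_l v l ord0 * routing W l i.
  apply: EFin_inj; rewrite -vE traffic_equation big_sumType/= EFinD -sumEFin.
  congr (_ + _)%E; last by apply: eq_bigr => l _; rewrite vE EFinM.
  rewrite (bigD1 i)//= eqxx mule1 event_rate_arrival big1 ?adde0// => l li.
  by rewrite eq_sym (negbTE li) mule0.
have vlam : v = lam + (routing W)^T *m v.
  apply/matrixP => i j; rewrite ord1 vi [RHS]mxE; congr (_ + _); rewrite mxE//.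
  by apply: eq_bigr => l _; rewrite [_^T _ _]mxE mulrC.
have inv : 1%:M - (routing W)^T \in unitmx.
  by rewrite -[1%:M]trmx1 -linearB/= unitmx_tr; exact: (routing_inv hW).
by rewrite vE /alpha -[\col_ _ _]/lam -[X in invmx _ *m X](addrK ((routing W)^T *m v))
  -vlam -{2}[v]mul1mx -mulmxBl mulKmx.
Qed.

End Stationary.

(** * Moments of the residual clocks *)

Section Tails.
Context {R : realType} {d1 d2 : measure_display} {S : measurableType d1}
  {Omega : measurableType d2} (pi : probability S R) (P : probability Omega R).
Variables (E : set S) (rho : S -> R) (tau : Omega -> R) (D : R).
Hypotheses (mE : measurable E) (mrho : measurable_fun [set: S] rho)
  (mtau : measurable_fun [set: Omega] tau) (D0 : 0 <= D).
Hypothesis tails : forall c,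
  (pi (E `&` [set x | (rho x < c)%R]) =
   D%:E * \int[P]_w (Num.min (Num.max (tau w) 0) (Num.max c 0))%:E)%E.

(** The region under the graph of [tau]. The measure with density D P(tau > s) on s >= 0 is realised
    as [D] times the image of P x Lebesgue on this region, so that Tonelli replaces handling a
    density. *)
Let cycle : set (Omega * measurableTypeR R) := [set z | 0 <= z.2 < tau z.1].

Let mcycle : measurable cycle.
Proof.
rewrite [X in measurable X](_ : _ =
  (setT `&` snd @^-1` `[0, +oo[) `&` (setT `&` [set z | z.2 < tau z.1])).
  apply: measurableI; first exact: measurable_snd.
  apply: (@measurable_lte _ (Omega * measurableTypeR R)%type R setT measurableT (fun z => z.2%:E)
     (fun z => (tau z.1)%:E)).
    by apply/measurable_EFinP; exact: measurable_snd.
  by apply/measurable_EFinP; exact: (measurableT_comp mtau measurable_fst).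
apply/seteqP; split => z; rewrite /cycle/= in_itv/= andbT.
  by case/andP.
by move=> [[_ z0] [_ z1]]; rewrite z0.
Qed.

Lemma lebesgue_itv_tail (t c : R) :
  lebesgue_measure (`[0, t[ `&` `]-oo, c[) =
  (Num.min (Num.max t 0) (Num.max c 0))%:E.
Proof.
have [tc|ct] := leP t c.
  rewrite (_ : _ `&` _ = `[0, t[%classic); last first.
    apply/seteqP; split => s /=; rewrite !in_itv/=; first by case.
    by move=> st; split => //; lra.
  have [t0|t0] := leP t 0.
    by rewrite set_itv_ge ?measure0 ?bnd_simp -?leNgt// min_l// le_max lexx orbT.
  by rewrite lebesgue_itvco ?subr0 ?ltW// min_l// le_max tc.
rewrite (_ : _ `&` _ = `[0, c[%classic); last first.
  apply/seteqP; split => s /=; rewrite !in_itv/=.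
    by move=> [/andP[s0 _] sc]; rewrite s0.
  by move=> st; split => //; lra.
have [c0|c0] := leP c 0.
  by rewrite set_itv_ge ?measure0 ?bnd_simp -?leNgt// min_r// le_max lexx orbT.
by rewrite lebesgue_itvco ?subr0 ?ltW// min_r// le_max (ltW ct).
Qed.

Lemma integral_of_tails (g : R -> \bar R) :
  measurable_fun [set: R] g -> (forall s, 0 <= g s)%E ->
  (\int[pi]_(x in E) g (rho x) =
   D%:E * \int[P]_w \int[lebesgue_measure]_(s in `[0%R, tau w[) g s)%E.
Proof.
move=> mg g0.
have mrho' : measurable_fun [set: S] (rho : S -> measurableTypeR R) := mrho.
have mg' : measurable_fun [set: measurableTypeR R] (g : measurableTypeR R -> \bar R) := mg.
pose RL := measurableTypeR R.
have msnd : measurable_fun [set: Omega * RL] (snd : Omega * RL -> RL) by [].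
pose Pl := (P \x (@lebesgue_measure R))%E.
pose mu : {measure set RL -> \bar R} :=
  measure_function_pushforward__canonical__measure_function_Measure (mrestr pi mE) mrho'.
pose nu0 : {measure set RL -> \bar R} :=
  measure_function_pushforward__canonical__measure_function_Measure (mrestr Pl mcycle) msnd.
pose nu : {measure set RL -> \bar R} := mscale (NngNum D0) nu0.
transitivity (\int[mu]_s g s)%E.
  rewrite [RHS](ge0_integral_pushforward mrho' (mrestr pi mE))//.
  by rewrite [RHS]ge0_integral_mrestr//=; exact: (measurableT_comp mg' mrho').
transitivity (\int[nu]_s g s)%E; last first.
  rewrite /nu ge0_integral_mscale//; congr (_ * _)%E.
  rewrite [LHS](ge0_integral_pushforward msnd (mrestr Pl mcycle))//.
  rewrite [LHS]ge0_integral_mrestr//=; last exact: (measurableT_comp mg' msnd).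
  rewrite integral_mkcond [LHS]fubini_tonelli1/=; first last.
  - by move=> z; rewrite patchE; case: ifP.
  - apply/(measurable_restrictT _ _).1 => //.
    by apply: measurable_funTS; exact: (measurableT_comp mg' msnd).
  apply: eq_integral => w _; rewrite /fubini_F [RHS]integral_mkcond.
  apply: eq_integral => s _; rewrite !patchE; congr (if _ then _ else _).
apply: eq_measure_integral => A mA _.
(* The rays ]-oo, c[ form a pi-system generating the Borel sets, the rays ]-oo, n[ exhaust the line
   with finite mass, and [tails] is the agreement on rays. *)
apply: (@measure_unique _ R RL [set A | exists x, A = `]-oo, x[%classic]
  (fun n => `]-oo, n%:R[%classic)).
- exact: RGenInftyO.measurableE.
- move=> _ _ [x ->] [y ->]; exists (Num.min x y).
  by apply/seteqP; split => s /=; rewrite !in_itv/= lt_min; [case=> -> ->|case/andP].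
- by move=> n; exists n%:R.
- apply/seteqP; split => // s _; exists (Num.truncn s).+1 => //=.
  by rewrite in_itv/=; exact: truncnS_gt.
- move=> _ [c ->].
  transitivity (pi (E `&` [set x | (rho x < c)%R])).
    rewrite -[LHS]/(pi (rho @^-1` `]-oo, c[ `&` E)) setIC; congr (pi _).
  rewrite tails -[RHS]/(D%:E * Pl (snd @^-1` `]-oo, c[ `&` cycle))%E; congr (_ * _)%E.
  apply: eq_integral => w _ /=; rewrite -lebesgue_itv_tail.
  congr (lebesgue_measure _); apply/seteqP; split => s; rewrite /xsection/= inE /cycle/=;
    rewrite !in_itv/=; tauto.
- move=> k; apply: (@le_lt_trans _ _ (pi setT)); last by rewrite probability_setT ltry.
  rewrite -[leLHS]/(pi (rho @^-1` `]-oo, k%:R[ `&` E)); apply: le_measure; rewrite ?inE//.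
  apply: measurableI => //; rewrite -[X in measurable X]setTI.
  exact: mrho.
- exact: mA.
Qed.

End Tails.

Lemma integral_truncated_power (R : realType) (n : nat) (t c : R) : 0 <= c ->
  (\int[lebesgue_measure]_(s in `[0%R, t[) (s ^+ n * (c <= s)%R%:R)%:E =
   (n.+1%:R^-1 * (t ^+ n.+1 - c ^+ n.+1) * (c <= t)%R%:R)%:E)%E.
Proof.
move=> c0.
transitivity (\int[lebesgue_measure]_(s in `[0%R, t[ `&` `[c, +oo[) (s ^+ n)%:E)%E.
  rewrite integral_mkcondr; apply: eq_integral => s _; rewrite patchE.
  have -> : (s \in `[c, +oo[%classic) = (c <= s).
    by apply/idP/idP; rewrite inE/= in_itv/= andbT.
  by case: ifP; rewrite ?mulr1 ?mulr0.
have [ct|tc] := leP c t.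
  rewrite (_ : _ `&` _ = `[c, t[%classic) ?integral_power// ?mulr1//.
  apply/seteqP; split => s /=; rewrite !in_itv/= andbT.
    by move=> [/andP[_ ->] ->].
  by move=> /andP[cs ->]; split => //; rewrite (le_trans c0).
rewrite (_ : _ `&` _ = set0) ?integral_set0 ?mulr0//.
apply/seteqP; split => s //=; rewrite !in_itv/= andbT.
by move=> [/andP[_ st] cs]; have := lt_trans (le_lt_trans cs st) tc; rewrite ltxx.
Qed.

Lemma measurable_indicator_ge (R : realType) (d : measure_display)
    (S : measurableType d) (f : S -> R) (c : R) :
  measurable_fun [set: S] f -> measurable_fun [set: S] (fun w => (c <= f w)%R%:R : R).
Proof.
move=> mf; apply: (measurableT_comp (f := fun b : bool => b%:R : R)) => //.
by apply: measurable_fun_ler => //; exact: measurable_cst.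
Qed.

Lemma measurable_truncated_power (R : realType) (n : nat) (c : R) :
  measurable_fun [set: R] ((fun s => (s ^+ n * (c <= s)%R%:R)%:E) : R -> \bar R).
Proof.
apply/measurable_EFinP; apply: measurable_funM; first exact: exprn_measurable.
exact: (measurable_indicator_ge c (@measurable_id _ _ _)).
Qed.

Lemma truncated_power_ge0 (R : realType) (n : nat) (c s : R) : 0 <= c ->
  (0 <= (s ^+ n * (c <= s)%R%:R)%:E)%E.
Proof.
move=> c0; rewrite lee_fin; case: (leP c s) => cs; rewrite ?mulr0 ?mulr1//.
by rewrite exprn_ge0// (le_trans c0).
Qed.

Section Moments.
Context {R : realType} {J K : nat} (N : network R J K) (tie : tie_rule K).
Hypothesis htie : tie_rule_ok tie.
Context {d : measure_display} {Omega : measurableType d}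
  {P : probability Omega R} (W : primitives N P).
Hypothesis hW : primitives_ok W.
Variable pi : probability (state R K) R.
Hypothesis hpi : stationary W tie pi.

Lemma clock_moment (e : @event K) (n : nat) (c : R) : index_valid N e -> 0 <= c ->
  (\int[pi]_(x in [set y | enabled N y e])
     (residual x e ^+ n * (c <= residual x e)%R%:R)%:E =
   event_rate tie W pi e * (n.+1%:R^-1 * mean_clock N e ^+ n.+1)%:E *
   \int[P]_w ((draw_clock (prim_draws W w) e 0 ^+ n.+1
      - c ^+ n.+1 / mean_clock N e ^+ n.+1)
      * (c <= mean_clock N e * draw_clock (prim_draws W w) e 0)%R%:R)%:E)%E.
Proof.
move=> ve c0; set m := mean_clock N e; pose D w := draw_clock (prim_draws W w) e 0.
have m0 : 0 < m by exact: mean_clock_gt0.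
have D0 w : 0 <= D w by exact: (prim_draws_ge0 hW).
have mD : measurable_fun [set: Omega] D.
  by rewrite /D; have [ma ms _] := measurable_prim_draws W; case: (e) => k.
have mE : measurable [set y : state R K | enabled N y e].
  exact: (@discrete_enabled _ _ _ N _ _ idfun (@measurable_id _ _ _) e).
have mmD : measurable_fun [set: Omega] (fun w => m * D w).
  by apply: measurable_funM => //; exact: measurable_cst.
have mres := @measurable_residual R K _ _ idfun (@measurable_id _ (state R K) _) e.
set r := event_rate tie W pi e.
have rE : (fine r)%:E = r by rewrite fineK// event_rate_fin.
have r0 : 0 <= fine r.
  by rewrite fine_ge0//; apply: nneseries_ge0 => k _ _; exact: measure_ge0.
have tails b : (pi ([set y | enabled N y e] `&` [set x | (residual x e < b)%R]) =
   (fine r)%:E * \int[P]_w (Num.min (Num.max (m * D w) 0) (Num.max b 0))%:E)%E.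
  have mmin : measurable_fun [set: Omega]
      (fun w => (Num.min (Num.max (m * D w) 0) (Num.max b 0))%:E).
    by apply/measurable_EFinP; apply: measurable_minr => //; exact: measurable_maxr.
  have min0 s : 0 <= Num.min (Num.max s 0) (Num.max b 0).
    by rewrite le_min !le_max !lexx !orbT.
  (* The integrand is at most [Num.max b 0]; the mean is thus a real number, as [clock_rate]
     demands. *)
  have fmin : (\int[P]_w (Num.min (Num.max (m * D w) 0) (Num.max b 0))%:E)%E \is a fin_num.
    rewrite ge0_fin_numE; last by apply: integral_ge0 => w _; rewrite lee_fin.
    apply: (@le_lt_trans _ _ (\int[P]_w (Num.max b 0)%:E)%E).
      apply: ge0_le_integral => //.
      - by move=> w _; rewrite lee_fin.
      - by move=> w _; rewrite lee_fin ge_min lexx orbT.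
    by rewrite integral_cst//= probability_setT mule1 ltry.
  rewrite rE -(fineK fmin).
  rewrite -(clock_rate htie hW hpi (A := `]-oo, b[%classic)
    (f := fun s => Num.min (Num.max s 0) (Num.max b 0)) ve)//.
  - by apply: measurable_minr => //; exact: measurable_maxr.
  - by rewrite maxxx min_l// le_max lexx orbT.
  - by move=> a s h h0 hs; exact: lebesgue_shift_lt.
  - by rewrite fineK.
have mg := @measurable_truncated_power R n c.
have g0 s := @truncated_power_ge0 R n c s c0.
rewrite (integral_of_tails mE mres mmD r0 tails mg g0) rE -muleA; congr (_ * _)%E.
have h0 w : 0 <= (D w ^+ n.+1 - c ^+ n.+1 / m ^+ n.+1) * (c <= m * D w)%R%:R.
  case: (leP c (m * D w)) => cs; rewrite ?mulr0 ?mulr1// subr_ge0 ler_pdivrMr ?exprn_gt0//.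
  by rewrite -exprMn [D w * m]mulrC lerXn2r ?nnegrE// (le_trans c0).
rewrite -ge0_integralZl_EFin//.
- apply: eq_integral => w _; rewrite integral_truncated_power// -EFinM; congr (_%:E).
  have mn0 : m ^+ n.+1 != 0 by rewrite expf_neq0// gt_eqF.
  (* Taking out m^(n+1) leaves the normalised clock. This is one power of m more than in the final
     formulas, where it is combined with the event rate. *)
  have -> : (m * D w) ^+ n.+1 - c ^+ n.+1 =
      m ^+ n.+1 * (D w ^+ n.+1 - c ^+ n.+1 / m ^+ n.+1).
    by rewrite mulrBr exprMn; congr (_ - _); rewrite mulrCA mulfV// mulr1.
  by rewrite !mulrA.
- by move=> w _; rewrite lee_fin; exact: h0.
- apply/measurable_EFinP; apply: measurable_funM; last exact: measurable_indicator_ge.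
  by apply: measurable_funB => //; exact: measurable_funX.
- by rewrite mulr_ge0 ?invr_ge0 ?exprn_ge0// ltW.
Qed.

End Moments.

Theorem lemma6p4 (R : realType) (J K : nat) (N : network R J K)
    (d : measure_display) (Omega : measurableType d) (P : probability Omega R)
    (W : primitives N P) (hW : primitives_ok W)
    (tie : tie_rule K) (htie : tie_rule_ok tie)
    (d' : measure_display) (Omega' : measurableType d')
    (Q : probability Omega' R) (X : {RV Q >-> state R K})
    (hX : stationary W tie (distribution Q X))
    (n : nat) (c : R) (hc : 0 <= c) :
  (forall k : 'I_K, k \in external N ->
    'E_Q[fun w => (Rarr (X w) k ^+ n * (c <= Rarr (X w) k)%R%:R)%R]
    = (n.+1%:R^-1 * mean_arrival N k ^+ n)%:E *
      'E_P[fun w =>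
        ((arr W k 0%N w ^+ n.+1 - c ^+ n.+1 / mean_arrival N k ^+ n.+1)
         * (c <= mean_arrival N k * arr W k 0%N w)%R%:R)%R])%E
  /\
  (forall k : 'I_K,
    'E_Q[fun w => (Rsrv (X w) k ^+ n *
                   [&& (c <= Rsrv (X w) k)%R, (0 < Zc (X w) k)%N
                     & [forall l in Hplus N k, Zc (X w) l == 0%N]]%:R)%R]
    = (n.+1%:R^-1 * gamma W k * mean_service N k ^+ n)%:E *
      'E_P[fun w =>
        ((srv W k 0%N w ^+ n.+1 - c ^+ n.+1 / mean_service N k ^+ n.+1)
         * (c <= mean_service N k * srv W k 0%N w)%R%:R)%R])%E.
Proof.
(* Under the law of [X] the indicator of [e] being enabled turns into the domain of integration. *)
have lhs (e : @event K) : index_valid N e ->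
    (\int[Q]_w (residual (X w) e ^+ n *
       ((c <= residual (X w) e)%R && enabled N (X w) e)%:R)%:E =
     \int[distribution Q X]_(x in [set y | enabled N y e])
       (residual x e ^+ n * (c <= residual x e)%R%:R)%:E)%E.
  move=> ve; rewrite [RHS]integral_mkcond ge0_integral_distribution/=.
  - apply: eq_integral => w _; rewrite patchE.
    have -> : (X w \in [set y | enabled N y e]) = enabled N (X w) e.
      by apply/idP/idP; rewrite inE.
    by case: (enabled N (X w) e); rewrite ?andbT// andbF mulr0.
  - apply/(measurable_restrictT _ _).1.
      exact: (@discrete_enabled _ _ _ N _ _ idfun (@measurable_id _ _ _) e).
    apply: measurable_funTS.
    apply: (measurableT_comp (@measurable_truncated_power R n c)).
    exact: (@measurable_residual _ _ _ _ idfun (@measurable_id _ _ _) e).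
  - by move=> x; rewrite patchE; case: ifP => // _; exact: truncated_power_ge0.
split=> k.
  move=> kE; have ve : index_valid N (inl k) by exact: kE.
  rewrite unlock.
  transitivity (\int[Q]_w (residual (X w) (inl k) ^+ n *
       ((c <= residual (X w) (inl k))%R && enabled N (X w) (inl k))%:R)%:E)%E.
    by apply: eq_integral => w _; rewrite /= kE andbT.
  rewrite lhs// (clock_moment htie hW hX n ve hc) event_rate_arrival//.
  congr (_ * _)%E; rewrite -EFinM; congr (_%:E).
  (* The rate lambda_k cancels one factor a_k of a_k^(n+1). *)
  rewrite /= /mean_arrival exprS; field.
  by rewrite nat1r pnatr_eq0/= gt_eqF// arrival_rate_gt0.
rewrite unlock.
transitivity (\int[Q]_w (residual (X w) (inr k) ^+ n *
     ((c <= residual (X w) (inr k))%R && enabled N (X w) (inr k))%:R)%:E)%E.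
  by apply: eq_integral => w _.
rewrite lhs// (clock_moment htie hW hX n (e := inr k) isT hc) event_rate_service//.
congr (_ * _)%E; rewrite -EFinM; congr (_%:E).
(* Here alpha_k takes one factor of m_k^(n+1) to form gamma_k. *)
rewrite /gamma exprS/=; ring.
Qed.
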